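(* Let $r$ be an odd positive integer not divisible by any of $3,5,17,257,641,65537,6700417$. Then there exist infinitely many primes $p$ such that $2^{\alpha}p\in G_r$ for all nonnegative integers $\alpha$.
   Context: For a positive integer $r$, the $r$-th Schemmel totient function $S_r:\mathbb{N}\to\mathbb{N}_0$ is the multiplicative arithmetic function (so $S_r(1)=1$ and $S_r(ab)=S_r(a)S_r(b)$ for coprime $a,b$) defined on prime powers by $S_r(p^{\alpha})=0$ if $p\le r$ and $S_r(p^\alpha)=p^{\alpha-1}(p-r)$ if $p>r$, for all primes $p$ and positive integers $\alpha$. $G_r$ denotes the set of positive integers not in the range of $S_r$. *)

(* Defs.v *)
From mathcomp Require Import all_boot.
Set Implicit Arguments. Unset Strict Implicit. Unset Printing Implicit Defensive.

Definition schemmel (r n : nat) : nat :=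
  \prod_(p <- primes n) (if p <= r then 0 else p ^ (logn p n).-1 * (p - r)).

Definition in_G (r m : nat) : Prop :=
  0 < m /\ ~ (exists n, 0 < n /\ schemmel r n = m).

(* Main.v *)
Require Import Defs.
From mathcomp Require Import all_boot.
From mathcomp Require Import all_order all_algebra all_fingroup all_solvable.
From mathcomp Require Import all_field all_character all_reals sequences exp.
From mathcomp Require Import complex boolp Rstruct.
From mathcomp Require Import lra zify ring.
Set Implicit Arguments. Unset Strict Implicit. Unset Printing Implicit Defensive.

(* If [2 ^ a * p = S_r n] with [p] prime and [3 %| p - r], some prime [q] dividing [n] satisfies
   [p %| q ^ (e - 1) * (q - r)].  The case [q = p] is excluded by [3 %| p - r], so that
   [q = 2 ^ b * p + r].  Since the Fermat number [2 ^ 2 ^ i + 1] divides [2 ^ b + 1] when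
   [b = 2 ^ i * odd], and [641 * 6700417 = 2 ^ 32 + 1], the congruences
   [p = r mod 3, 5, 17, 257, 65537, 6700417] and [p = - r mod 641] make all [2 ^ b * p + r]
   composite.

   The primes [p] come from Dirichlet's theorem, proved by Shapiro's elementary method:
   if the partial sums of [sum chi n / n] stay away from 0 then [sum chi n Lambda n / n] is bounded,
   and otherwise (the series vanishes) it is [- ln x + O(1)].  Vanishing contradicts
   [3 + 4 cos t + cos (2 t) >= 0] when [chi ^ 2] is not principal, and Monsky's argument with
   the Lambert series [sum chi n t ^ n / (1 - t ^ n)], [t -> 1], when [chi] is real. *)

Import Order.TTheory GRing.Theory Num.Theory.
Local Open Scope ring_scope.

(** * Divisor sums *)

(** What makes the covering finite is that the fifth Fermat number is composite. The primes 3, 5,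
    17, 257, 65537 treat the exponents [b] of 2-adic valuation 0 to 4, where [2 ^ b * p + r] is
    [r - p] modulo the prime. The factor 6700417 treats valuation 5 in the same way, which frees 641
    for all the rest: there [2 ^ b] is 1 and the value is [p + r], whence the opposite sign. The
    prime divisors forbidden to [r] are those for which the class prescribed for [p] would not be
    coprime to the modulus. In Dirichlet's theorem no limit [L(1, chi)] is ever formed: all sums are
    finite, and vanishing is a rate of decay. Two non-vanishing arguments are needed because, when
    [chi ^ 2] is principal, its sum grows like [ln x] and the trigonometric inequality only yields
    [3 - 4 + 1 = 0] times [ln x]. For real [chi] the Lambert series has nonnegative coefficients, at
    least 1 at squares, so it is large near [t = 1], whereas vanishing would keep it bounded. *)

Lemma sum_divisors_wide (V : nmodType) n N (F : nat -> V) : (0 < n <= N)%N ->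
  \sum_(d <- divisors n) F d = \sum_(1 <= d < N.+1 | (d %| n)%N) F d.
Proof.
case/andP=> n0 nN; rewrite -[RHS]big_filter; apply: perm_big.
apply: uniq_perm; rewrite ?divisors_uniq ?filter_uniq ?iota_uniq // => d.
rewrite -dvdn_divisors // mem_filter mem_index_iota ltnS.
have [dn|//] := boolP (d %| n)%N.
by rewrite (dvdn_gt0 n0 dn) (leq_trans (dvdn_leq n0 dn) nN).
Qed.

Lemma sum_multiples (V : nmodType) d x (F : nat -> V) : (0 < d)%N ->
  \sum_(1 <= n < x.+1 | (d %| n)%N) F (n %/ d)%N
    = \sum_(1 <= m < (x %/ d).+1) F m.
Proof.
move=> d0; rewrite -big_filter.
rewrite (perm_big [seq (d * m)%N | m <- index_iota 1 (x %/ d).+1]) /=.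
  by rewrite big_map; apply: eq_bigr => m _; rewrite mulKn.
apply: uniq_perm; first by rewrite filter_uniq ?iota_uniq.
  rewrite map_inj_uniq ?iota_uniq // => a b /eqP.
  by rewrite eqn_pmul2l // => /eqP.
move=> n; rewrite mem_filter mem_index_iota; apply/idP/mapP.
  case/andP=> /dvdnP[m ->]; rewrite muln_gt0 ltnS => /andP[/andP[m0 _] mx].
  by exists m; rewrite 1?mulnC // mem_index_iota m0 ltnS leq_divRL.
case=> m; rewrite mem_index_iota ltnS leq_divRL // => /andP[m0 mx] ->.
by rewrite dvdn_mulr // muln_gt0 d0 m0 ltnS mulnC.
Qed.

(** Both sides run over the pairs [(d, m)] with [d * m <= x]. Every Dirichlet convolution below is
    summed through this exchange. *)
Lemma sum_divisors_exchange (V : nmodType) x (F : nat -> nat -> V) :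
  \sum_(1 <= n < x.+1) \sum_(d <- divisors n) F d (n %/ d)%N
    = \sum_(1 <= d < x.+1) \sum_(1 <= m < (x %/ d).+1) F d m.
Proof.
transitivity (\sum_(1 <= n < x.+1) \sum_(1 <= d < x.+1 | (d %| n)%N)
    F d (n %/ d)%N).
  apply: eq_big_nat => n /andP[n0 nx].
  by rewrite (sum_divisors_wide (N := x)) // n0.
under eq_bigr do rewrite big_mkcond.
rewrite exchange_big /=; apply: eq_big_nat => d /andP[d0 _].
by rewrite -big_mkcond /= sum_multiples.
Qed.

(** By coprimality each divisor is [p ^ j * d] for unique [j] and [d], [j] being recovered by
    [logn]. With [pdiv_pfactor], divisor sums can be treated one prime at a time. *)
Lemma sum_divisors_pfactor (V : nmodType) p a m (F : nat -> V) :
  prime p -> coprime p m -> (0 < m)%N ->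
  \sum_(d <- divisors (p ^ a * m)) F d
    = \sum_(d <- divisors m) \sum_(0 <= j < a.+1) F (p ^ j * d)%N.
Proof.
move=> pp cpm m0; rewrite -[RHS](big_allpairs_dep (h := fun d j => (p ^ j * d)%N)).
have p0 := prime_gt0 pp.
have logd j d : (d %| m)%N -> logn p (p ^ j * d) = j.
  move=> dm; have d0 := dvdn_gt0 m0 dm.
  rewrite lognM ?expn_gt0 ?p0 // pfactorK // logn_coprime ?addn0 //.
  exact: coprime_dvdr dm cpm.
apply: perm_big; apply: uniq_perm; first exact: divisors_uniq.
  apply: allpairs_uniq; rewrite ?divisors_uniq ?iota_uniq //.
  move=> x y Hx Hy E.
  case/allpairsP: Hx E => -[d j] /= [dm _ ->].
  case/allpairsP: Hy => -[e i] /= [em _ ->] /= E.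
  rewrite -!dvdn_divisors // in dm em.
  have ij : j = i by rewrite -(logd j d dm) E logd.
  rewrite ij in E *; move/eqP: E.
  by rewrite eqn_pmul2l ?expn_gt0 ?p0 // => /eqP ->.
move=> d; rewrite -dvdn_divisors ?muln_gt0 ?expn_gt0 ?p0 //.
apply/idP/allpairsP => [dpm|[[e j] /= [em ja ->]]].
  have d0 : (0 < d)%N by apply: dvdn_gt0 dpm; rewrite muln_gt0 expn_gt0 p0.
  have [e cpe de] := pfactor_coprime pp d0.
  exists (e, logn p d) => /=; split; last by rewrite mulnC.
    rewrite -dvdn_divisors // -(@Gauss_dvdr _ (p ^ a)) ?coprimeXr //.
      by apply: dvdn_trans dpm; rewrite [X in (_ %| X)%N]de dvdn_mulr.
    by rewrite coprime_sym.
  rewrite mem_index_iota ltnS leq0n /= -(dvdn_Pexp2l _ _ (prime_gt1 pp)).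
  rewrite -(@Gauss_dvdl _ _ m) ?coprimeXl //.
  by apply: dvdn_trans dpm; rewrite [X in (_ %| X)%N]de dvdn_mull.
rewrite mem_index_iota ltnS /= in ja; rewrite -dvdn_divisors // in em.
by rewrite dvdn_mul // dvdn_exp2l.
Qed.

Lemma pdiv_pfactor n : (1 < n)%N -> exists p a m,
  [/\ prime p, (0 < a)%N, coprime p m, (0 < m)%N & n = (p ^ a * m)%N].
Proof.
move=> n1; have pp := pdiv_prime n1; have n0 := ltnW n1.
have [m cpm nE] := pfactor_coprime pp n0.
exists (pdiv n), (logn (pdiv n) n), m; split=> //; last by rewrite mulnC.
  by rewrite logn_gt0 pi_pdiv.
by move: n0; rewrite nE muln_gt0 => /andP[].
Qed.

Lemma primes_pfactor p a m : prime p -> (0 < a)%N -> coprime p m -> (0 < m)%N ->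
  perm_eq (primes (p ^ a * m)) (p :: primes m).
Proof.
move=> pp a0 cpm m0; have p0 := prime_gt0 pp.
apply: uniq_perm; rewrite ?primes_uniq //= ?primes_uniq ?andbT.
  by rewrite mem_primes pp m0 /= -prime_coprime.
move=> q; rewrite primesM ?expn_gt0 ?p0 // primesX // primes_prime //.
by rewrite !inE.
Qed.

Definition moebius {R : pzRingType} (n : nat) : R :=
  \prod_(p <- primes n) (if logn p n == 1%N then -1 else 0).

Lemma moebius1 (R : pzRingType) : moebius 1 = 1 :> R.
Proof. by rewrite /moebius big_nil. Qed.

Lemma moebius_pfactor (R : comPzRingType) p a m :
  prime p -> (0 < a)%N -> coprime p m -> (0 < m)%N ->
  moebius (p ^ a * m) = (if a == 1%N then - moebius m else 0) :> R.
Proof.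
move=> pp a0 cpm m0; have p0 := prime_gt0 pp.
rewrite /moebius (perm_big _ (primes_pfactor pp a0 cpm m0)) big_cons.
rewrite lognM ?expn_gt0 ?p0 // pfactorK // logn_coprime // addn0.
case: eqP => _ /=; rewrite ?mul0r // mulN1r; congr (- _).
apply: eq_big_seq => q; rewrite mem_primes => /and3P[pq _ qm].
rewrite lognM ?expn_gt0 ?p0 // lognX logn_prime //.
have [qp|_] := eqVneq q p; last by rewrite muln0 add0n.
by move: cpm; rewrite prime_coprime // -qp qm.
Qed.

Lemma normr_moebius (R : realDomainType) n : `|moebius n| <= 1 :> R.
Proof.
rewrite /moebius normr_prod; apply: prodr_ile1 => p _; rewrite normr_ge0.
by case: ifP; rewrite ?normrN1 ?normr0 ?lexx ?ler01.
Qed.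

Lemma sum_moebius (R : comPzRingType) n : (0 < n)%N ->
  \sum_(d <- divisors n) moebius d = (n == 1%N)%:R :> R.
Proof.
case: n => // -[|n] _; first by rewrite big_seq1 moebius1.
have [p [a [m [pp a0 cpm m0 nE]]]] := @pdiv_pfactor n.+2 isT.
rewrite [in divisors _]nE sum_divisors_pfactor //; rewrite big_seq big1 // => d.
rewrite -dvdn_divisors // => dm; have d0 := dvdn_gt0 m0 dm.
have cpd := coprime_dvdr dm cpm.
(* Only the exponents 0 and 1 of [p] survive, and they cancel. *)
rewrite big_nat_recl // big_ltn // mul1n moebius_pfactor //= big_nat big1 ?addr0 ?subrr //.
move=> j /andP[j0 _]; rewrite moebius_pfactor //; last by case: j j0.
Qed.

Section Mangoldt.
Variable R : realType.
Implicit Types (n m p x : nat).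

Lemma lnM_nat m n : (0 < m)%N -> (0 < n)%N ->
  ln ((m * n)%:R : R) = ln m%:R + ln n%:R.
Proof. by move=> m0 n0; rewrite natrM lnM // posrE ltr0n. Qed.

Lemma ln_nat_ge0 n : 0 <= ln (n%:R : R).
Proof.
by case: n => [|n]; [rewrite ln0 | rewrite ln_ge0 // ler1n].
Qed.

Lemma ln_nat_le m n : (0 < m <= n)%N -> ln (m%:R : R) <= ln n%:R.
Proof.
by case/andP=> m0 mn; rewrite ler_ln ?posrE ?ltr0n ?ler_nat // (leq_trans m0).
Qed.

(** Prime powers are recognised by their single prime divisor, so no exponent has to be
    extracted. *)
Definition mangoldt n : R :=
  if size (primes n) == 1%N then ln (head 0%N (primes n))%:R else 0.

Lemma mangoldt1 : mangoldt 1 = 0. Proof. by []. Qed.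

Lemma mangoldt_ge0 n : 0 <= mangoldt n.
Proof. by rewrite /mangoldt; case: ifP => // _; apply: ln_nat_ge0. Qed.

Lemma mangoldt_pfactor p a m :
  prime p -> (0 < a)%N -> coprime p m -> (0 < m)%N ->
  mangoldt (p ^ a * m) = if m == 1%N then ln p%:R else 0.
Proof.
move=> pp a0 cpm m0; have Hp := primes_pfactor pp a0 cpm m0.
rewrite /mangoldt (perm_size Hp) /= eqSS size_eq0 primes_eq0.
case: eqP Hp => [->|/eqP m1] Hp.
  by rewrite /= (perm_small_eq _ Hp).
by have -> : (m < 2)%N = false by case: m m0 m1 {cpm Hp} => [|[]].
Qed.

Lemma sum_mangoldt n : (0 < n)%N ->
  \sum_(d <- divisors n) mangoldt d = ln n%:R.
Proof.
elim/ltn_ind: n => -[//|[|n]] IH _; first by rewrite big_seq1 mangoldt1 ln1.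
have [p [a [m [pp a0 cpm m0 nE]]]] := @pdiv_pfactor n.+2 isT.
have p0 := prime_gt0 pp; have pa1 : (1 < p ^ a)%N by rewrite -(exp1n a) ltn_exp2r ?prime_gt1.
have mn : (m < n.+2)%N by rewrite nE -[X in (X < _)%N]mul1n ltn_pmul2r.
rewrite nE sum_divisors_pfactor // lnM_nat ?expn_gt0 ?p0 //.
have -> : \sum_(d <- divisors m) \sum_(0 <= j < a.+1) mangoldt (p ^ j * d)
    = \sum_(d <- divisors m) (mangoldt d + (if d == 1%N then ln p%:R *+ a else 0)).
  apply: eq_big_seq => d; rewrite -dvdn_divisors // => dm.
  have d0 := dvdn_gt0 m0 dm; have cpd := coprime_dvdr dm cpm.
  rewrite big_nat_recl // mul1n; congr (_ + _).
  under eq_bigr do rewrite mangoldt_pfactor //.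
  by rewrite big_const_nat subn0 -/(iterop _ _ _ _) iter_addr_0; case: eqP; rewrite ?mul0rn.
rewrite big_split /= IH // addrC natrX lnXn ?ltr0n //; congr (_ + _).
rewrite (bigD1_seq 1%N) ?divisor1 ?divisors_uniq //= big1 ?addr0 // => d.
by move/negPf ->.
Qed.

(** For [d] dividing the part prime to [p], the exponents 0 and 1 of [p] contribute
    [moebius d * (ln d - ln (p * d))], that is [- ln p * moebius d]; the sum over [d] then detects
    [m = 1]. *)
Lemma sum_moebius_ln n : (0 < n)%N ->
  \sum_(d <- divisors n) moebius d * ln d%:R = - mangoldt n.
Proof.
case: n => // -[|n] _; first by rewrite big_seq1 ln1 mulr0 mangoldt1 oppr0.
have [p [a [m [pp a0 cpm m0 ->]]]] := @pdiv_pfactor n.+2 isT.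
rewrite sum_divisors_pfactor // mangoldt_pfactor //.
have -> : \sum_(d <- divisors m) \sum_(0 <= j < a.+1)
      moebius (p ^ j * d) * ln (p ^ j * d)%:R
    = \sum_(d <- divisors m) (moebius d * (- ln (p%:R : R))).
  apply: eq_big_seq => d; rewrite -dvdn_divisors // => dm.
  have d0 := dvdn_gt0 m0 dm; have cpd := coprime_dvdr dm cpm.
  rewrite big_nat_recl // big_ltn // mul1n moebius_pfactor //= expn1.
  rewrite big_nat big1 ?addr0 => [|j /andP[j0 _]].
    by rewrite lnM_nat ?(prime_gt0 pp) // mulNr mulrDr opprD addrCA subrr addr0 mulrN.
  by rewrite moebius_pfactor //; case: j j0 => // j _; rewrite mul0r.
rewrite -mulr_suml sum_moebius //.
by case: eqP; rewrite ?mul1r ?mul0r ?oppr0.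
Qed.

End Mangoldt.

(** * Estimates of Chebyshev and Mertens *)

Section Chebyshev.
Variable R : realType.
Implicit Types (n m p x d : nat).

Local Notation mangoldt := (mangoldt R).

Lemma lnS_le n : (0 < n)%N -> ln (n.+1%:R : R) - ln n%:R <= n%:R^-1.
Proof.
move=> n0; have nR : 0 < n%:R :> R by rewrite ltr0n.
rewrite -ln_div ?posrE ?ltr0n // -natr1 mulrDl divff ?gt_eqF // div1r.
by apply: le_ln1Dx; apply: (@lt_trans _ _ 0); rewrite ?invr_gt0 // ltrN10.
Qed.

Lemma ln_nat_lt n : ln (n%:R : R) <= n%:R.
Proof.
by case: n => [|n]; [rewrite ln0 | rewrite ltW // ln_sublinear // ltr0n].
Qed.

Lemma ln_fact x : ln (x`!%:R : R) = \sum_(1 <= n < x.+1) ln n%:R.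
Proof.
elim: x => [|x IH]; first by rewrite fact0 ln1 big_nil.
by rewrite factS lnM_nat ?fact_gt0 // big_nat_recr //= -IH addrC.
Qed.

(** Legendre's formula in logarithmic form: [x %/ d] counts the multiples of [d] up to [x]. *)
Lemma ln_fact_mangoldt x :
  ln (x`!%:R : R) = \sum_(1 <= d < x.+1) mangoldt d * (x %/ d)%:R.
Proof.
rewrite ln_fact; under eq_big_nat => n /andP[n0 _] do rewrite -sum_mangoldt //.
rewrite (sum_divisors_exchange x (fun d _ => mangoldt d)).
by apply: eq_bigr => d _; rewrite sumr_const_nat subSS subn0 mulr_natr.
Qed.

Lemma ln_fact_ge x : x%:R * ln x%:R - x%:R <= ln (x`!%:R : R).
Proof.
elim: x => [|x IH]; first by rewrite fact0 ln1 mul0r subr0.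
rewrite factS lnM_nat ?fact_gt0 //.
case: x IH => [|x] IH; first by rewrite fact0 ln1; lra.
have /(ler_wpM2l (ler0n R x.+1)) := @lnS_le x.+1 isT.
rewrite divff ?pnatr_eq0 // => H.
by rewrite -[x.+2%:R as X in X * _ - X]natr1; lra.
Qed.

Lemma ln_fact_le x : ln (x`!%:R : R) <= x%:R * ln x%:R.
Proof.
have -> : x%:R * ln x%:R = \sum_(1 <= n < x.+1) ln (x%:R : R).
  by rewrite sumr_const_nat subSS subn0 mulr_natl.
rewrite ln_fact; by rewrite !big_nat ler_sum // => n; rewrite ltnS => nx; rewrite ln_nat_le.
Qed.

Lemma divn_ler x d : (0 < d)%N -> (x %/ d)%:R <= x%:R / d%:R :> R.
Proof.
by move=> d0; rewrite ler_pdivlMr ?ltr0n // -natrM ler_nat leq_trunc_div.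
Qed.

Lemma ltr_divnS x d : (0 < d)%N -> x%:R / d%:R < (x %/ d).+1%:R :> R.
Proof.
by move=> d0; rewrite ltr_pdivrMr ?ltr0n // -natrM ltr_nat ltn_ceil.
Qed.

Lemma bin_le_exp2 m n : ('C(m, n) <= 2 ^ m)%N.
Proof.
have [mn|nm] := ltnP m n; first by rewrite bin_small.
rewrite -[2%N]/(1 + 1)%N expnDn (bigD1 (inord n)) //= inordK ?ltnS //.
by rewrite !exp1n !muln1 leq_addr.
Qed.

(** Chebyshev's argument: in the logarithm of the central binomial coefficient, [mangoldt d] has
    coefficient [n.*2 %/ d - 2 * (n %/ d)], never negative and at least 1 for [n < d <= n.*2]. The
    binomial is at most [2 ^ n.*2], and [ln 2 <= 1]. *)
Lemma psi_double n : \sum_(n.+1 <= d < n.*2.+1) mangoldt d <= n.*2%:R.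
Proof.
have bound : ln (n.*2`!%:R : R) - 2 * ln (n`!)%:R <= n.*2%:R.
  have E : (n.*2`! = 'C(n.*2, n) * (n`! * n`!))%N.
    have n2 : (n <= n.*2)%N by rewrite -addnn leq_addr.
    by rewrite -(bin_fact n2) -[X in (X - _)%N]addnn addnK.
  have C0 : (0 < 'C(n.*2, n))%N by rewrite bin_gt0 -addnn leq_addr.
  rewrite E !lnM_nat ?muln_gt0 ?fact_gt0 //.
  have : ln ('C(n.*2, n)%:R : R) <= ln (2 ^ n.*2)%:R.
    by rewrite ln_nat_le // C0 bin_le_exp2.
  rewrite natrX lnXn ?ltr0n // => H.
  have ln2 : ln (2 : R) <= 1.
    by have := @lnS_le 1 isT; rewrite ln1 invr1 subr0.
  have : ln (2 : R) *+ n.*2 <= n.*2%:R by rewrite lerMn2r ln2 orbT.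
  lra.
apply: le_trans bound; rewrite !ln_fact_mangoldt.
have -> : \sum_(1 <= d < n.+1) mangoldt d * (n %/ d)%:R
    = \sum_(1 <= d < n.*2.+1) mangoldt d * (n %/ d)%:R.
  rewrite [RHS](@big_cat_nat _ _ _ n.+1) //=;
  last by rewrite ltnS -addnn leq_addr.
  rewrite [X in _ = _ + X]big_nat [X in _ = _ + X]big1 ?addr0 // => d.
  by case/andP=> nd _; rewrite divn_small // mulr0.
rewrite mulr_sumr -sumrB (@big_cat_nat _ _ _ n.+1 1 n.*2.+1) //=;
  last by rewrite ltnS -addnn leq_addr.
rewrite -[X in X <= _]add0r lerD //.
  rewrite big_nat sumr_ge0 // => d /andP[d0 _].
  rewrite mulrCA -mulrBr mulr_ge0 ?mangoldt_ge0 // subr_ge0 -natrM ler_nat.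
  by rewrite leq_divRL // mul2n -doubleMl leq_double leq_trunc_div.
rewrite !big_nat ler_sum // => d /andP[nd d2n].
rewrite [X in _ - 2 * (_ * X%:R)]divn_small // mulr0 mulr0 subr0.
rewrite ler_peMr ?mangoldt_ge0 // ler1n divn_gt0 //; lia.
Qed.

(** Halving: induction and [psi_double] bound the sum up to [2 * h] by [6 * h], for [h = n./2]. The
    slack up to [4 * n] absorbs the last term of an odd [n], which is at most [2 * h + 1]. *)
Lemma psi_le n : \sum_(1 <= d < n.+1) mangoldt d <= 4 * n%:R.
Proof.
elim/ltn_ind: n => n IH.
case: (leqP n 1) => [n1|n1].
  by case: n n1 {IH} => [|[|//]] _; rewrite ?big_nil ?big_nat1 ?mangoldt1 mulr_ge0.
have h0 : (0 < n./2)%N by lia.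
have Hn : (n./2 < n)%N by lia.
have psi2 : \sum_(1 <= d < n./2.*2.+1) mangoldt d <= 6 * n./2%:R.
  rewrite (@big_cat_nat _ _ _ n./2.+1) //=; last by lia.
  have := IH _ Hn; have := psi_double n./2.
  by rewrite -[in X in _ <= X -> _]mul2n natrM; lra.
rewrite -[in X in X <= _](odd_double_half n) -[in X in _ <= X](odd_double_half n).
have h1 : 1 <= n./2%:R :> R by rewrite ler1n.
case: (odd n); last by rewrite add0n -mul2n natrM mul2n; lra.
rewrite add1n big_nat_recr //=.
have mle : mangoldt n./2.*2.+1 <= n./2.*2.+1%:R.
  rewrite -[X in _ <= X]/((n./2.*2.+1)%:R); apply: le_trans (ln_nat_lt _).
  rewrite -sum_mangoldt // (bigD1_seq n./2.*2.+1) ?divisors_uniq ?divisors_id //=.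
  by rewrite lerDl sumr_ge0 // => d _; apply: mangoldt_ge0.
have E : n./2.*2.+1%:R = 2 * n./2%:R + 1 :> R by rewrite -natr1 -mul2n natrM.
by rewrite E in mle *; lra.
Qed.

Lemma mertens_ge x : (0 < x)%N ->
  ln x%:R - 1 <= \sum_(1 <= d < x.+1) mangoldt d / d%:R.
Proof.
move=> x0; have xR : 0 < x%:R :> R by rewrite ltr0n.
rewrite -(ler_pM2l xR) mulrBr mulr1; apply: le_trans (ln_fact_ge x) _.
rewrite ln_fact_mangoldt mulr_sumr !big_nat ler_sum // => d /andP[d0 _].
by rewrite mulrCA ler_wpM2l ?mangoldt_ge0 ?divn_ler.
Qed.

(** Replacing [x / d] by [x %/ d] costs at most [mangoldt d] in each term, hence at most [4 * x] in
    all by [psi_le]; dividing by [x] gives the constant 4. *)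
Lemma mertens_le x : (0 < x)%N ->
  \sum_(1 <= d < x.+1) mangoldt d / d%:R <= ln x%:R + 4.
Proof.
move=> x0; have xR : 0 < x%:R :> R by rewrite ltr0n.
rewrite -(ler_pM2l xR) mulrDr -lerBlDr; apply: le_trans (ln_fact_le x).
rewrite lerBlDr [X in _ + X]mulrC; apply: le_trans (lerD (lexx _) (psi_le x)).
rewrite ln_fact_mangoldt mulr_sumr -big_split /= !big_nat ler_sum // => d.
case/andP=> d0 _; rewrite mulrCA -{3}[mangoldt d]mulr1 -mulrDr natr1.
by rewrite ler_wpM2l ?mangoldt_ge0 ?ltW ?ltr_divnS.
Qed.

(** On the right [p] runs over all integers from 2, not only over primes: the extra terms are
    nonnegative, and an unrestricted double sum is easier to exchange. *)
Lemma mangoldt_nonprime x n : (0 < n <= x)%N -> ~~ prime n ->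
  mangoldt n <= \sum_(2 <= p < x.+1) \sum_(2 <= j < x.+1)
                  (if n == (p ^ j)%N then ln p%:R else 0).
Proof.
case/andP=> n0 nx npr.
have nonneg k p j : 0 <= (if k == (p ^ j)%N then ln (p%:R : R) else 0).
  by case: ifP => // _; apply: ln_nat_ge0.
have [n1|n1] := leqP n 1.
  have -> : n = 1%N by lia.
  by rewrite mangoldt1; do 2!(apply: sumr_ge0 => ? _); apply: nonneg.
have [p [a [m [pp a0 cpm m0 nE]]]] := pdiv_pfactor n1.
rewrite [in X in X <= _]nE mangoldt_pfactor //; case: eqP => [m1|_]; last first.
  by do 2!(apply: sumr_ge0 => ? _); apply: nonneg.
rewrite m1 muln1 in nE; have p1 := prime_gt1 pp.
have a2 : (2 <= a)%N.
  rewrite ltn_neqAle a0 andbT; apply/eqP => a1.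
  by move: npr; rewrite nE -a1 expn1 pp.
have ax : (a <= x)%N by apply: leq_trans nx; rewrite nE ltnW // ltn_expl.
have px : (p <= x)%N.
  by apply: leq_trans nx; rewrite nE -{1}[p]expn1 leq_exp2l // ltnW.
rewrite (bigD1_seq p) ?iota_uniq ?mem_index_iota ?p1 //=.
rewrite (bigD1_seq a) ?iota_uniq ?mem_index_iota ?a2 //= nE eqxx -addrA lerDl.
by rewrite -nE addr_ge0 //; do ?(apply: sumr_ge0 => ? _).
Qed.

Lemma sum_geometric (q : R) n :
  (\sum_(2 <= j < n.+2) q ^+ j) * (1 - q) = q ^+ 2 - q ^+ n.+2.
Proof.
elim: n => [|n IH]; first by rewrite big_geq // mul0r subrr.
by rewrite big_nat_recr //= mulrDl IH [q ^+ n.+3]exprS; ring.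
Qed.

(** The telescoping term is a discrete form of [(ln t + 1) / t], an antiderivative of
    [- ln t / t ^ 2]. *)
Lemma sum_ln_telescope n :
  \sum_(2 <= p < n.+2) ln p%:R / (p%:R * (p%:R - 1))
    <= ln 2 + 1 - (ln n.+2%:R + 1) / (n.+2%:R - 1) :> R.
Proof.
elim: n => [|n IH].
  by rewrite big_geq // [2 - 1](_ : _ = 1 :> R) ?divr1 ?subrr //; lra.
rewrite big_nat_recr //=; set u : R := ln n.+2%:R in IH *.
have := @lnS_le n.+2 isT; rewrite -/u; set v : R := ln n.+3%:R => uv.
have E : n.+3%:R = n.+2%:R + 1 :> R by rewrite natr1.
have y1 : 1 < n.+2%:R :> R by rewrite ltr1n.
rewrite E addrK; move: n.+2%:R IH uv y1 => y IH uv y1.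
apply: le_trans (lerD IH (lexx _)) _.
suff : (v + 1) / y + u / (y * (y - 1)) <= (u + 1) / (y - 1) by lra.
have y0 : 0 < y by lra.
have y1' : 0 < y - 1 by lra.
have -> : (v + 1) / y + u / (y * (y - 1)) = ((v + 1) * (y - 1) + u) / y / (y - 1).
  by field; rewrite !gt_eqF.
rewrite ler_pM2r ?invr_gt0 // ler_pdivrMr //.
have H : (v - u) * y <= 1 by rewrite -ler_pdivlMr // div1r.
have [vu|vu] := leP 0 (v - u); nra.
Qed.

(** The powers of [p] from the square on contribute at most [ln p / (p * (p - 1))], whose sum stays
    below [ln 2 + 1]. This is what turns estimates on prime powers into estimates on primes. *)
Lemma sum_mangoldt_nonprime x :
  \sum_(1 <= n < x.+1 | ~~ prime n) mangoldt n / n%:R <= 2.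
Proof.
case: x => [|x]; first by rewrite big_geq.
apply: (@le_trans _ _ (\sum_(1 <= n < x.+2) \sum_(2 <= p < x.+2)
   \sum_(2 <= j < x.+2) (if n == (p ^ j)%N then ln p%:R / (p ^ j)%:R else 0))).
  rewrite big_mkcond !big_nat ler_sum // => n n1x.
  case: ifP => npr; last first.
    do 2!(apply: sumr_ge0 => ? _); case: ifP => // _.
    by rewrite divr_ge0 ?ln_nat_ge0.
  rewrite ler_pdivrMr ?ltr0n //; last by case/andP: n1x.
  apply: le_trans (mangoldt_nonprime n1x npr) _.
  rewrite mulr_suml ler_sum // => p _; rewrite mulr_suml ler_sum // => j _.
  case: eqP => [->|_]; last by rewrite mul0r.
  case: (posnP (p ^ j)) => [/eqP|pj].
    by rewrite expn_eq0 => /andP[/eqP -> _]; rewrite ln0 // !mul0r.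
  by rewrite divfK // pnatr_eq0 -lt0n.
rewrite exchange_big /=.
apply: (@le_trans _ _ (\sum_(2 <= p < x.+2) ln (p%:R : R) / (p%:R * (p%:R - 1)))).
  rewrite !big_nat ler_sum // => p /andP[p2 _]; rewrite exchange_big /=.
  have p1 : 1 < p%:R :> R by rewrite ltr1n.
  have q1 : 0 < 1 - p%:R^-1 :> R by rewrite subr_gt0 invf_lt1 // (lt_trans ltr01).
  apply: (@le_trans _ _ (ln p%:R * \sum_(2 <= j < x.+2) p%:R^-1 ^+ j)).
    rewrite mulr_sumr ler_sum // => j _; rewrite -big_mkcond /=.
    have [pjx|pjx] := boolP ((p ^ j)%N \in index_iota 1 x.+2).
      rewrite (eq_bigl (fun n => n == (p ^ j)%N)) //.
      rewrite big_mkcond (bigD1_seq _ pjx) ?iota_uniq //= eqxx big1 ?addr0.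
        by rewrite natrX exprVn.
      by move=> n /negPf ->.
    rewrite big_seq_cond big1 ?mulr_ge0 ?ln_nat_ge0 ?exprn_ge0 ?invr_ge0 //.
    by move=> n /andP[nx /eqP nE]; rewrite -nE nx in pjx.
  apply: ler_wpM2l; first exact: ln_nat_ge0.
  rewrite -(ler_pM2r q1) sum_geometric.
  have -> : (p%:R * (p%:R - 1))^-1 * (1 - p%:R^-1) = p%:R^-1 ^+ 2 :> R.
    by field; rewrite ?subr_eq0 !gt_eqF // (lt_trans ltr01).
  by rewrite lerBlDr lerDl exprn_ge0 ?invr_ge0.
apply: le_trans (sum_ln_telescope x) _.
have ln2 : ln (2 : R) <= 1 by have := @lnS_le 1 isT; rewrite ln1 invr1 subr0.
have : 0 <= (ln x.+2%:R + 1) / (x.+2%:R - 1) :> R.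
  by rewrite divr_ge0 // ?subr_ge0 ?ler1n // addr_ge0 ?ln_nat_ge0.
lra.
Qed.

End Chebyshev.

(** * Sums over a Dirichlet character *)

Import ComplexField.Normc.
Local Open Scope complex_scope.

(** * Real-valued norm on the complex numbers, and summation by parts *)

Section ComplexNorm.
Variable R : rcfType.
Implicit Types (x y : R) (z w : R[i]).

Lemma normc_ge0 z : 0 <= normc z.
Proof. by case: z => a b; apply: sqrtr_ge0. Qed.

Lemma ler_normcD z w : normc (z + w) <= normc z + normc w.
Proof. by rewrite -lecR rmorphD; apply: (ler_normD z w). Qed.

Lemma normcN z : normc (- z) = normc z.
Proof. by case: z => a b /=; rewrite !sqrrN. Qed.

Lemma normc_real x : normc x%:C = `|x|.
Proof. by rewrite /= expr0n addr0 sqrtr_sqr. Qed.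

Lemma normcZ x z : normc (x%:C * z) = `|x| * normc z.
Proof. by rewrite normcM normc_real. Qed.

Lemma ler_normc_sum I (s : seq I) (P : pred I) (F : I -> R[i]) :
  normc (\sum_(i <- s | P i) F i) <= \sum_(i <- s | P i) normc (F i).
Proof.
elim/big_rec2: _ => [|i y z _ H]; first by rewrite normc0.
by apply: le_trans (ler_normcD _ _) _; rewrite lerD2l.
Qed.

Lemma normc_Re z : `|complex.Re z| <= normc z.
Proof.
case: z => a b /=; rewrite -sqrtr_sqr ler_wsqrtr // lerDl sqr_ge0 //.
Qed.

Lemma Re_real x : complex.Re x%:C = x. Proof. by []. Qed.

Lemma ReD z w : complex.Re (z + w) = complex.Re z + complex.Re w.
Proof. by case: z w => [? ?] []. Qed.

Lemma ReN z : complex.Re (- z) = - complex.Re z.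
Proof. by case: z. Qed.

Lemma ReZ x z : complex.Re (x%:C * z) = x * complex.Re z.
Proof. by case: z => a b /=; rewrite mul0r subr0. Qed.

Lemma Re_sum I (s : seq I) (P : pred I) (F : I -> R[i]) :
  complex.Re (\sum_(i <- s | P i) F i) = \sum_(i <- s | P i) complex.Re (F i).
Proof. by elim/big_rec2: _ => // i y z _ <-; rewrite ReD. Qed.

(** Summation by parts, the differences of the weights telescoping. The bound does not depend on
    [M], so it controls tails without any limit. *)
Lemma abel_summation (a : nat -> R[i]) (f : nat -> R) (B : R) m M :
  (forall i, (m <= i)%N -> normc (\sum_(m <= n < i) a n) <= B) ->
  (forall n, (m <= n)%N -> 0 <= f n) ->
  (forall n, (m <= n)%N -> f n.+1 <= f n) ->
  normc (\sum_(m <= n < M) (f n)%:C * a n) <= B * f m.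
Proof.
move=> aB f0 fd; have B0 : 0 <= B.
  by apply: le_trans (aB m _); rewrite // normc_ge0.
have [Mm|mM] := leqP M m; first by rewrite big_geq // normc0 mulr_ge0 ?f0.
have byparts i : (m <= i)%N -> \sum_(m <= n < i) (f n)%:C * a n
    = (f i)%:C * \sum_(m <= n < i) a n
      + \sum_(m <= n < i) (f n - f n.+1)%:C * \sum_(m <= j < n.+1) a j.
  move=> mi; rewrite -(subnKC mi); elim: (i - m)%N => [|l IH].
    by rewrite addn0 !big_geq // mulr0 addr0.
  rewrite addnS [LHS]big_nat_recr ?leq_addr //= IH.
  rewrite [X in _ = _ + X]big_nat_recr ?leq_addr //=.
  rewrite [X in (f (m + l).+1)%:C * X]big_nat_recr ?leq_addr //=.
  rewrite [X in _ + (_ + _ * X)]big_nat_recr ?leq_addr //=.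
  by rewrite rmorphB; ring.
rewrite byparts 1?ltnW //; apply: le_trans (ler_normcD _ _) _.
have -> : B * f m = B * f M + B * \sum_(m <= n < M) (f n - f n.+1).
  have -> : \sum_(m <= n < M) (f n - f n.+1) = f m - f M.
    rewrite -opprB -telescope_sumr 1?ltnW // -sumrN.
    by apply: eq_bigr => n _; rewrite opprB.
  by ring.
apply: lerD.
  rewrite normcZ ger0_norm ?f0 1?ltnW // mulrC ler_wpM2r ?f0 1?ltnW //.
  by rewrite aB // ltnW.
apply: le_trans (ler_normc_sum _ _ _) _.
rewrite mulr_sumr !big_nat ler_sum // => n /andP[mn _].
have H : 0 <= f n - f n.+1 by rewrite subr_ge0 fd.
by rewrite normcZ ger0_norm // mulrC ler_wpM2r // aB // ltnW.
Qed.

End ComplexNorm.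

Record dchar (R : rcfType) (k : nat) (chi : nat -> R[i]) : Prop := Dchar {
  dchar1 : chi 1%N = 1;
  dcharM : forall m n, chi (m * n)%N = chi m * chi n;
  dchar_mod : forall n, chi (n %% k)%N = chi n;
  dchar_eq0 : forall n, ~~ coprime k n -> chi n = 0;
  dchar_norm1 : forall n, coprime k n -> normc (chi n) = 1
}.

Definition nonprincipal (R : rcfType) (k : nat) (chi : nat -> R[i]) : Prop :=
  exists2 a, coprime k a & chi a != 1.

Section LSums.
Variable R : realType.
Variable k : nat.
Hypothesis k0 : (0 < k)%N.
Implicit Types (chi : nat -> R[i]).

Lemma dchar_norm chi n : dchar k chi -> normc (chi n) <= 1.
Proof.
move=> cchi; have [cn|cn] := boolP (coprime k n).
  by rewrite (dchar_norm1 cchi).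
by rewrite (dchar_eq0 cchi) // normc0 ler01.
Qed.

(** Multiplication by [a] permutes the residues, so the sum is fixed by the factor [chi a], which is
    not 1. *)
Lemma dchar_sum_period chi : dchar k chi -> nonprincipal k chi ->
  \sum_(i < k) chi i = 0.
Proof.
move=> cchi [a cka achi].
pose h (i : 'I_k) : 'I_k := Ordinal (ltn_pmod (a * i) k0).
have h_inj : injective h.
  move=> i j [] H; apply: val_inj; move: H.
  wlog ij : i j / (i <= j)%N => [Hw H|].
    by case: (leqP i j) => [|/ltnW] ij; [|symmetry]; apply: Hw.
  move/esym/eqP; rewrite eqn_mod_dvd ?leq_mul2l ?ij ?orbT // -mulnBr Gauss_dvdr //.
  rewrite /dvdn modn_small ?subn_eq0 => [ji|]; last first.
    by apply: leq_ltn_trans (leq_subr _ _) _.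
  by apply/eqP; rewrite eqn_leq ij ji.
apply/eqP; have : chi a * \sum_(i < k) chi i == \sum_(i < k) chi i.
  rewrite [X in _ == X](reindex_inj h_inj) mulr_sumr; apply/eqP.
  by apply: eq_bigr => i _; rewrite /= (dchar_mod cchi) (dcharM cchi).
by rewrite -subr_eq0 -[X in _ - X]mul1r -mulrBl mulf_eq0 subr_eq0 (negPf achi).
Qed.

Lemma dchar_block chi m : dchar k chi -> nonprincipal k chi ->
  \sum_(m <= n < m + k) chi n = 0.
Proof.
move=> cchi nchi; elim: m => [|m IH].
  by rewrite add0n big_mkord dchar_sum_period.
have mk : (m < m + k)%N by rewrite -[X in (X < _)%N]addn0 ltn_add2l.
move: IH; rewrite big_ltn // addSn big_nat_recr //=.
by rewrite -(dchar_mod cchi (m + k)) modnDr (dchar_mod cchi) addrC.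
Qed.

Lemma dchar_partial_sum chi m M : dchar k chi -> nonprincipal k chi ->
  normc (\sum_(m <= n < M) chi n) <= k%:R.
Proof.
move=> cchi nchi; have [n] := ubnP (M - m)%N.
elim: n m => // n IH m Mn; have [kM|kM] := leqP k (M - m).
  rewrite (@big_cat_nat _ _ _ (m + k)) ?leq_addr //=; last by lia.
  by rewrite dchar_block // add0r IH //; lia.
apply: le_trans (ler_normc_sum _ _ _) _.
apply: (@le_trans _ _ (\sum_(m <= n0 < M) 1)).
  by apply: ler_sum => i _; apply: dchar_norm.
by rewrite sumr_const_nat ler_nat ltnW.
Qed.

(** Partial sums of [L(1, chi)] and, for [Psum], of [- L' / L] at 1. *)
Definition Lsum chi x : R[i] := \sum_(1 <= m < x.+1) (m%:R^-1)%:C * chi m.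
Definition Psum chi x : R[i] :=
  \sum_(1 <= d < x.+1) (mangoldt R d / d%:R)%:C * chi d.

Lemma Lsum_tail chi x y : dchar k chi -> nonprincipal k chi -> (x <= y)%N ->
  normc (Lsum chi y - Lsum chi x) <= k%:R / x.+1%:R.
Proof.
move=> cchi nchi xy; rewrite /Lsum (@big_cat_nat _ _ _ x.+1 1 y.+1) //=.
rewrite addrAC subrr add0r.
apply: (@abel_summation _ chi (fun n => n%:R^-1)) => [i _|n _|n xn].
- exact: dchar_partial_sum.
- by rewrite invr_ge0.
- by rewrite lef_pV2 ?posrE ?ltr0n ?ler_nat //; lia.
Qed.

(* By [Lsum_tail], this says that the limit [L(1, chi)] of the partial sums is 0. *)
Definition Lvanish chi := forall y, normc (Lsum chi y) <= k%:R / y.+1%:R.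

(** If the bound of [Lvanish] fails at [y], the norm at [y] exceeds, by some [d > 0], all that later
    terms can change according to [Lsum_tail]. *)
Lemma Lsum_dichotomy chi : dchar k chi -> nonprincipal k chi ->
  ~ Lvanish chi ->
  exists2 d : R, 0 < d & exists x0, forall x, (x0 <= x)%N -> d <= normc (Lsum chi x).
Proof.
move=> cchi nchi /existsNP[y /negP]; rewrite -ltNge => Hy.
exists (normc (Lsum chi y) - k%:R / y.+1%:R); first by rewrite subr_gt0.
exists y => x yx; rewrite lerBlDr.
have := ler_normcD (Lsum chi x) (- (Lsum chi x - Lsum chi y)).
rewrite normcN opprB addrCA subrr addr0.
by move/le_trans; apply; rewrite lerD2l; apply: Lsum_tail.
Qed.

Lemma ln_div_nonincr n : (4 <= n)%N ->
  ln (n.+1%:R : R) / n.+1%:R <= ln n%:R / n%:R.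
Proof.
move=> n4; have n0 : (0 < n)%N by lia.
have nR : 0 < n%:R :> R by rewrite ltr0n.
rewrite ler_pdivrMr ?ltr0n // mulrAC ler_pdivlMr // -natr1.
have H : (ln n.+1%:R - ln n%:R) * n%:R <= 1 :> R.
  by rewrite -ler_pdivlMr // div1r lnS_le.
(* The cutoff 4 comes from here: [ln 4] is [2 * ln 2], and [ln 2 >= 1 / 2] follows from
   [ln (1 + y) <= y] at [y = - 1 / 2]. *)
have ln4 : 1 <= ln n%:R :> R.
  apply: (@le_trans _ _ (ln 4%:R)); last by rewrite ln_nat_le.
  rewrite (_ : 4 = 2 * 2)%N // lnM_nat //.
  have : ln (1 + - 2^-1 : R) <= - 2^-1 by apply: le_ln1Dx; lra.
  have -> : 1 + - 2^-1 = 2^-1 :> R by lra.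
  by rewrite lnV ?posrE //; lra.
by rewrite natr1; nra.
Qed.

Lemma Lsum_ln_bounded chi x : dchar k chi -> nonprincipal k chi ->
  normc (\sum_(1 <= n < x.+1) (ln n%:R / n%:R)%:C * chi n) <= 3 + k%:R.
Proof.
move=> cchi nchi.
have small M : (M <= 4)%N ->
    normc (\sum_(1 <= n < M) (ln n%:R / n%:R)%:C * chi n) <= 3.
  move=> M4; apply: le_trans (ler_normc_sum _ _ _) _.
  apply: (@le_trans _ _ (\sum_(1 <= n < M) 1)).
    rewrite !big_nat ler_sum // => n /andP[n0 _].
    rewrite normcZ ger0_norm ?divr_ge0 ?ln_nat_ge0 // mulr_ile1 ?normc_ge0 //.
    - by rewrite divr_ge0 ?ln_nat_ge0.
    - by rewrite ler_pdivrMr ?ltr0n // mul1r ln_nat_lt.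
    - exact: dchar_norm.
  by rewrite sumr_const_nat ler_nat; lia.
have [x4|x4] := leqP x.+1 4; first by apply: le_trans (small _ x4) _; rewrite lerDl.
rewrite (@big_cat_nat _ _ _ 4) //=; last exact: ltnW.
apply: le_trans (ler_normcD _ _) _; apply: lerD; first exact: small.
apply: (@le_trans _ _ (k%:R * (ln 4%:R / 4%:R))).
  apply: (@abel_summation _ chi (fun n => ln n%:R / n%:R)) => [i _|n _|n].
  - exact: dchar_partial_sum.
  - by rewrite divr_ge0 ?ln_nat_ge0.
  - exact: ln_div_nonincr.
by rewrite ler_piMr // ler_pdivrMr // mul1r ln_nat_lt.
Qed.

Lemma inv_floor_le x d : (0 < d <= x)%N ->
  k%:R / (x %/ d).+1%:R <= k%:R * d%:R / x%:R :> R.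
Proof.
case/andP=> d0 dx; have x0 : (0 < x)%N by apply: leq_trans dx.
rewrite -mulrA ler_wpM2l // -[d%:R / _]invf_div.
by rewrite lef_pV2 ?posrE ?ltr0n ?divr_gt0 ?ltr0n // ltW // ltr_divnS.
Qed.

(** The identity of [sum_mangoldt], twisted by [chi], which is completely multiplicative. *)
Lemma Lsum_ln_mangoldt chi x : dchar k chi ->
  \sum_(1 <= n < x.+1) (ln n%:R / n%:R)%:C * chi n
  = \sum_(1 <= d < x.+1) (mangoldt R d / d%:R)%:C * chi d * Lsum chi (x %/ d).
Proof.
move=> cchi; under [RHS]eq_bigr do rewrite mulr_sumr.
rewrite -(sum_divisors_exchange x (fun d m =>
  (mangoldt R d / d%:R)%:C * chi d * ((m%:R^-1)%:C * chi m))).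
apply: eq_big_nat => n /andP[n0 _].
rewrite -sum_mangoldt // mulr_suml rmorph_sum mulr_suml.
apply: eq_big_seq => d; rewrite -dvdn_divisors // => dn.
rewrite mulrACA -(dcharM cchi) -rmorphM mulnC divnK //.
by rewrite -mulrA -invfM -natrM mulnC divnK.
Qed.

(** By [Lsum_ln_mangoldt], the product of [Psum] and [Lsum] differs from a bounded sum by the cost
    of replacing each [Lsum chi (x %/ d)] with [Lsum chi x]. One replacement costs at most
    [k * d / x], so the total is at most [k / x] times Chebyshev's sum, hence at most [4 * k]. It
    remains to divide by the lower bound on [Lsum]. *)
Lemma Psum_bounded chi : dchar k chi -> nonprincipal k chi -> ~ Lvanish chi ->
  exists C : R, exists x0, forall x, (x0 <= x)%N -> normc (Psum chi x) <= C.
Proof.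
move=> cchi nchi /(Lsum_dichotomy cchi nchi)[d d0 [x0 Hd]].
exists ((3 + 5 * k%:R) / d), x0.+1 => x xx0; have x_gt0 : (0 < x)%N by lia.
have xR : 0 < x%:R :> R by rewrite ltr0n.
rewrite ler_pdivlMr //; apply: (@le_trans _ _ (normc (Psum chi x * Lsum chi x))).
  by rewrite normcM ler_wpM2l ?normc_ge0 // Hd // ltnW.
have -> : Psum chi x * Lsum chi x
  = \sum_(1 <= n < x.+1) (ln n%:R / n%:R)%:C * chi n
    + \sum_(1 <= d < x.+1) (mangoldt R d / d%:R)%:C * chi d
        * (Lsum chi x - Lsum chi (x %/ d)).
  rewrite Lsum_ln_mangoldt // -big_split mulr_suml /=; apply: eq_bigr => e _.
  by rewrite -mulrDr addrC subrK.
apply: le_trans (ler_normcD _ _) _.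
have -> : 3 + 5 * k%:R = 3 + k%:R + k%:R * 4 :> R by ring.
apply: lerD; first exact: Lsum_ln_bounded.
apply: le_trans (ler_normc_sum _ _ _) _.
apply: (@le_trans _ _ (\sum_(1 <= e < x.+1) mangoldt R e * (k%:R / x%:R))).
  rewrite !big_nat ler_sum // => e /andP[e0 ex].
  rewrite -mulrA normcZ ger0_norm ?divr_ge0 ?mangoldt_ge0 // -mulrA.
  rewrite ler_wpM2l ?mangoldt_ge0 // ler_pdivrMl ?ltr0n // normcM.
  have -> : e%:R * (k%:R / x%:R) = 1 * (k%:R * e%:R / x%:R) :> R by ring.
  apply: ler_pM; rewrite ?normc_ge0 ?dchar_norm //.
  apply: le_trans (inv_floor_le _); last by rewrite e0.
  by apply: Lsum_tail => //; apply: leq_div.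
rewrite -mulr_suml mulrCA ler_wpM2l // ler_pdivrMr // ?psi_le //.
Qed.

(** The weights [w d], which are [moebius d * ln (x / d)], have divisor sums [mangoldt n], plus
    [ln x] at [n = 1], so the left side is a combination of the [Lsum chi (x %/ d)]. Vanishing makes
    these at most [k * d / x], and the sum of [ln (x / d)] over [d <= x] is at most [x] by
    [ln_fact_ge]. *)
Lemma Psum_vanish chi x : dchar k chi -> Lvanish chi -> (0 < x)%N ->
  normc (Psum chi x + (ln x%:R)%:C) <= k%:R.
Proof.
move=> cchi Lv x_gt0; have xR : 0 < x%:R :> R by rewrite ltr0n.
pose w d : R := moebius d * (ln x%:R - ln d%:R).
have -> : Psum chi x + (ln x%:R)%:C
  = \sum_(1 <= d < x.+1) (w d / d%:R)%:C * chi d * Lsum chi (x %/ d).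
  under [RHS]eq_bigr do rewrite mulr_sumr.
  rewrite -(sum_divisors_exchange x (fun d m =>
    (w d / d%:R)%:C * chi d * ((m%:R^-1)%:C * chi m))).
  have -> : (ln x%:R)%:C = \sum_(1 <= n < x.+1)
      (if n == 1%N then (ln x%:R)%:C else 0) :> R[i].
    rewrite big_ltn // eqxx big_nat big1 ?addr0 // => n /andP[n1 _].
    by rewrite gtn_eqF.
  rewrite -big_split /=; apply: eq_big_nat => n /andP[n0 _].
  transitivity ((\sum_(d <- divisors n) w d)%:C * ((n%:R^-1)%:C * chi n)).
    have -> : \sum_(d <- divisors n) w d
      = (n == 1%N)%:R * ln x%:R + mangoldt R n.
      under eq_bigr do rewrite /w mulrBr.
      rewrite sumrB -mulr_suml sum_moebius // sum_moebius_ln // opprK //.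
    rewrite rmorphD mulrDl addrC; congr (_ + _).
      case: eqP => [->|_]; last by rewrite !mul0r.
      by rewrite invr1 (dchar1 cchi) !mulr1 mul1r.
    by rewrite mulrA -rmorphM.
  rewrite rmorph_sum mulr_suml; apply: eq_big_seq => d.
  rewrite -dvdn_divisors // => dn.
  rewrite mulrACA -(dcharM cchi) -rmorphM mulnC divnK //.
  by rewrite -mulrA -invfM -natrM mulnC divnK // mulrA -rmorphM.
apply: le_trans (ler_normc_sum _ _ _) _.
apply: (@le_trans _ _ (\sum_(1 <= e < x.+1) (ln x%:R - ln e%:R) * (k%:R / x%:R))).
  rewrite !big_nat ler_sum // => e /andP[e0 ex].
  have H : 0 <= ln x%:R - ln e%:R :> R by rewrite subr_ge0 ln_nat_le ?e0.
  have nw : `|w e| <= ln x%:R - ln e%:R.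
    by rewrite normrM [X in _ * X]ger0_norm // ler_piMl // normr_moebius.
  rewrite -mulrA normcZ normrM -mulrA.
  apply: ler_pM => //; first by rewrite mulr_ge0 ?normc_ge0.
  rewrite ger0_norm ?invr_ge0 // ler_pdivrMl ?ltr0n // normcM.
  have -> : e%:R * (k%:R / x%:R) = 1 * (k%:R * e%:R / x%:R) :> R by ring.
  apply: ler_pM; rewrite ?normc_ge0 ?dchar_norm //.
  by apply: le_trans (Lv _) (inv_floor_le _); rewrite e0.
rewrite -mulr_suml sumrB -ln_fact sumr_const_nat subSS subn0.
rewrite mulrA ler_pdivrMr // mulrC ler_wpM2l // -[ln _ *+ x]mulr_natl.
by have := ln_fact_ge R x; lra.
Qed.

Lemma ln_unbounded (C : R) x0 : exists2 x, (x0 < x)%N & C < ln x%:R.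
Proof.
exists (x0 + (Num.truncn (expR C)).+1)%N; first by rewrite addnS ltnS leq_addr.
rewrite -[X in X < _]expRK ltr_ln ?posrE ?expR_gt0 //; last by rewrite ltr0n addnS.
apply: lt_le_trans (truncnS_gt _) _.
by rewrite ler_nat leq_addl.
Qed.

Lemma dchar_sqr chi : dchar k chi -> dchar k (fun n => chi n ^+ 2).
Proof.
move=> cchi; split=> [|m n|n|n cn|n cn].
- by rewrite (dchar1 cchi) expr1n.
- by rewrite (dcharM cchi) exprMn.
- by rewrite (dchar_mod cchi).
- by rewrite (dchar_eq0 cchi) // expr0n.
- by rewrite expr2 normcM (dchar_norm1 cchi) // mulr1.
Qed.

(** With [cos t] the real part of [z], the expression is [2 * (1 + cos t) ^ 2]. *)
Lemma Re_341 (z : R[i]) : normc z = 1 ->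
  0 <= 3 + 4 * complex.Re z + complex.Re (z ^+ 2).
Proof.
case: z => a b /= ab1.
have : a ^+ 2 + b ^+ 2 = 1.
  by rewrite -[LHS]sqr_sqrtr ?addr_ge0 ?sqr_ge0 // ab1 expr1n.
by have := sqr_ge0 (1 + a); nra.
Qed.

Lemma Lsum_complex chi : dchar k chi ->
  nonprincipal k (fun n => chi n ^+ 2) -> ~ Lvanish chi.
Proof.
move=> cchi nchi2 Lv; have cchi2 := dchar_sqr cchi.
have [C [x0 HC]] : exists C, exists x0, forall x, (x0 < x)%N ->
    complex.Re (Psum (fun n => chi n ^+ 2) x) <= C.
  (* If the series of [chi ^ 2] vanishes too, its [Psum] is close to [- ln x], so an upper bound
     still holds. *)
  have [Lv2|Lv2] := EM (Lvanish (fun n => chi n ^+ 2)).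
    exists k%:R, 0%N => x x0.
    have := Psum_vanish cchi2 Lv2 x0.
    have := normc_Re (Psum (fun n => chi n ^+ 2) x + (ln x%:R)%:C).
    rewrite ReD Re_real ler_norml => /andP[_].
    by have := ln_nat_ge0 R x; lra.
  have [C [x0 HC]] := Psum_bounded cchi2 nchi2 Lv2.
  exists C, x0 => x /ltnW /HC; apply: le_trans.
  by apply: le_trans (normc_Re _); apply: ler_norm.
(* For this [x] the total [3 * (ln x + 4) + 4 * (k - ln x) + C] is negative. *)
have [x x0x lnx] := ln_unbounded (12 + 4 * k%:R + C) x0.
have x_gt0 : (0 < x)%N by lia.
have H1 := HC _ x0x; have H2 := mertens_le R x_gt0.
have := normc_Re (Psum chi x + (ln x%:R)%:C).
rewrite ReD Re_real ler_norml => /andP[_ H3]; have H4 := Psum_vanish cchi Lv x_gt0.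
suff : 0 <= 3 * (\sum_(1 <= d < x.+1) mangoldt R d / d%:R)
   + 4 * complex.Re (Psum chi x) + complex.Re (Psum (fun n => chi n ^+ 2) x) by lra.
rewrite !Re_sum !mulr_sumr -!big_split /= sumr_ge0 // => n _.
rewrite !ReZ.
have -> : forall u v w : R, 3 * u + 4 * (u * v) + u * w = u * (3 + 4 * v + w).
  by move=> *; ring.
rewrite mulr_ge0 ?divr_ge0 ?mangoldt_ge0 //.
have [cn|cn] := boolP (coprime k n); first by rewrite Re_341 // (dchar_norm1 cchi).
by rewrite (dchar_eq0 cchi) // expr0n /= mulr0 !addr0.
Qed.

End LSums.

(** * Non-vanishing for real characters *)

Section RealCharacterSums.
Variable R : realType.
Variable c : nat -> R.
Hypothesis cM : forall m n, c (m * n)%N = c m * c n.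
Hypothesis c1 : c 1%N = 1.
Hypothesis c_val : forall n, [\/ c n = 0, c n = 1 | c n = -1].

Let cX p j : c (p ^ j)%N = c p ^+ j.
Proof. by elim: j => [|j IH]; rewrite ?expn0 // expnS cM IH exprS. Qed.

(** The local factor at a prime: 1 for [e = 0], [a + 1] for [e = 1], and alternately 1 and 0 for
    [e = -1]. Even exponents, hence squares, always give at least 1. *)
Lemma sum_sign_powers (e : R) a : [\/ e = 0, e = 1 | e = -1] ->
  (~~ odd a)%:R <= \sum_(0 <= j < a.+1) e ^+ j.
Proof.
case=> ->.
- rewrite big_ltn // big_nat big1 ?addr0 => [|j /andP[j0 _]].
    by rewrite expr0 lern1; case: (odd a).
  by rewrite expr0n gtn_eqF.
- under eq_bigr do rewrite expr1n.
  by rewrite sumr_const_nat ler_nat; case: (odd a).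
suff -> : \sum_(0 <= j < a.+1) (-1) ^+ j = (~~ odd a)%:R :> R by [].
elim: a => [|a IH]; first by rewrite big_nat1.
rewrite big_nat_recr //= IH -signr_odd /=.
by case: (odd a); rewrite ?expr1 ?expr0 ?add0r ?subrr.
Qed.

Lemma sum_char_divisors_pfactor p a m : prime p -> coprime p m -> (0 < m)%N ->
  \sum_(d <- divisors (p ^ a * m)) c d
    = (\sum_(0 <= j < a.+1) c p ^+ j) * \sum_(d <- divisors m) c d.
Proof.
move=> pp cpm m0; rewrite sum_divisors_pfactor // mulr_sumr.
apply: eq_bigr => d _; rewrite mulr_suml; apply: eq_bigr => j _.
by rewrite cM cX.
Qed.

Lemma sum_char_divisors_ge0 n : (0 < n)%N -> 0 <= \sum_(d <- divisors n) c d.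
Proof.
elim/ltn_ind: n => -[//|[|n]] IH _; first by rewrite big_seq1 c1.
have [p [a [m [pp a0 cpm m0 nE]]]] := @pdiv_pfactor n.+2 isT.
have pa1 : (1 < p ^ a)%N by rewrite -(exp1n a) ltn_exp2r ?prime_gt1.
have mn : (m < n.+2)%N by rewrite nE -[X in (X < _)%N]mul1n ltn_pmul2r.
rewrite nE sum_char_divisors_pfactor // mulr_ge0 ?IH //.
by apply: le_trans (sum_sign_powers a (c_val p)).
Qed.

Lemma sum_char_divisors_sqr n : (0 < n)%N -> 1 <= \sum_(d <- divisors (n ^ 2)) c d.
Proof.
elim/ltn_ind: n => -[//|[|n]] IH _; first by rewrite big_seq1 c1.
have [p [a [m [pp a0 cpm m0 nE]]]] := @pdiv_pfactor n.+2 isT.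
have pa1 : (1 < p ^ a)%N by rewrite -(exp1n a) ltn_exp2r ?prime_gt1.
have mn : (m < n.+2)%N by rewrite nE -[X in (X < _)%N]mul1n ltn_pmul2r.
rewrite nE expnMn -expnM sum_char_divisors_pfactor ?coprimeXr ?expn_gt0 ?m0 //.
have := sum_sign_powers (a * 2) (c_val p); rewrite oddM andbF /= => H.
by rewrite -[1]mulr1 ler_pM ?IH.
Qed.

End RealCharacterSums.

(** * Monsky's Lambert series, truncated *)

Section Lambert.
Variable R : realType.
Variable t : R.
Hypothesis t01 : 0 < t < 1.

Let t0 : 0 < t. Proof. by case/andP: t01. Qed.
Let t1 : t < 1. Proof. by case/andP: t01. Qed.

Let S d := \sum_(0 <= i < d) t ^+ i.

Let SE d : S d * (1 - t) = 1 - t ^+ d.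
Proof.
rewrite /S; elim: d => [|d IH]; first by rewrite big_geq // mul0r expr0 subrr.
by rewrite big_nat_recr //= mulrDl IH exprS; ring.
Qed.

(** The geometric mean of [1, t, ..., t ^ d] is [t ^ (d / 2)]; the square root makes it the integral
    power [u ^ d]. *)
Let u := Num.sqrt t.
Let u0 : 0 < u. Proof. by rewrite sqrtr_gt0. Qed.
Let u1 : u < 1. Proof. by rewrite -sqrtr1 ltr_sqrt. Qed.
Let uE : t = u ^+ 2. Proof. by rewrite sqr_sqrtr // ltW. Qed.

Let S2 d : S d.+2 = 1 + t ^+ d.+1 + t * S d.
Proof.
rewrite /S big_nat_recr //= big_nat_recl // mulr_sumr.
under eq_bigr do rewrite exprS.
by rewrite expr0; ring.
Qed.

(* AM-GM, pairing the extreme terms of the geometric sum *)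
Let S_amgm d : d.+1%:R * u ^+ d <= S d.+1.
Proof.
suff : d.+1%:R * u ^+ d <= S d.+1 /\ d.+2%:R * u ^+ d.+1 <= S d.+2 by case.
elim: d => [|d [IH1 IH2]].
  have E : S 2 = 1 + t by rewrite /S big_nat_recr //= big_nat1 expr0 expr1.
  rewrite E {1}/S big_nat1 expr0 mulr1 expr1 uE; split=> //.
  by have := sqr_ge0 (1 - u); nra.
split=> //; rewrite S2.
have /(ler_wpM2l (ltW t0)) := IH1; rewrite [X in X <= _](_ : _ = d.+1%:R * u ^+ d.+2).
  have -> : t ^+ d.+2 = (u ^+ d.+2) ^+ 2 by rewrite uE -!exprM mulnC.
  have -> : d.+3%:R = 2 + d.+1%:R :> R by rewrite -natrD.
  by have := sqr_ge0 (1 - u ^+ d.+2); rewrite mulrDl; nra.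
by rewrite uE !exprS; ring.
Qed.

(** The Lambert term [t ^ d / (1 - t ^ d)] is compared with its main part, whose sum against [chi]
    is [L(1, chi) / (1 - t)] and disappears under vanishing. The difference is nonnegative and
    nonincreasing in [d], as [abel_summation] requires. *)
Let lambda d := (d%:R * (1 - t))^-1 - t ^+ d / (1 - t ^+ d).

Let tX1 d : (0 < d)%N -> 0 < 1 - t ^+ d.
Proof. by move=> d0; rewrite subr_gt0 exprn_ilt1 ?ltW // -lt0n. Qed.

Let S_gt0 d : (0 < d)%N -> 0 < S d.
Proof.
case: d => // d _; apply: lt_le_trans (S_amgm d).
by rewrite mulr_gt0 ?exprn_gt0.
Qed.

Let uXle m n : (m <= n)%N -> u ^+ n <= u ^+ m.
Proof. by move=> mn; rewrite ler_wiXn2l // ltW. Qed.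

Let lambdaE d : (0 < d)%N -> lambda d = (d%:R^-1 - t ^+ d / S d) / (1 - t).
Proof.
move=> d0; rewrite /lambda -SE; field.
by rewrite pnatr_eq0 -lt0n d0 subr_eq0 !gt_eqF // S_gt0.
Qed.

Let lambda_ge0 d : (0 < d)%N -> 0 <= lambda d.
Proof.
move=> d0; rewrite lambdaE // divr_ge0 ?subr_ge0 ?(ltW t1) //.
rewrite ler_pdivrMr ?S_gt0 // mulrC ler_pdivlMr ?ltr0n //.
case: d d0 => // d _; apply: le_trans (S_amgm d); rewrite mulrC ler_wpM2l //.
by rewrite uE -exprM uXle //; lia.
Qed.

Let lambda_nonincr d : (0 < d)%N -> lambda d.+1 <= lambda d.
Proof.
move=> d0; rewrite !lambdaE // ler_pM2r ?invr_gt0 ?subr_gt0 //.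
have dR : 0 < d%:R :> R by rewrite ltr0n.
have Sd := S_gt0 d0; have Sd1 := @S_gt0 d.+1 isT.
have SS : S d.+1 = S d * t + 1.
  have t1' : 1 - t != 0 by rewrite subr_eq0 gt_eqF.
  by apply: (mulIf t1'); rewrite SE mulrDl mulrAC SE exprS; ring.
(* The two factors on the right dominate [d * u ^ (d - 1)] and [d.+1 * u ^ d], and
   [u ^ (2 * d - 1) >= t ^ d]. *)
have key : d%:R * d.+1%:R * t ^+ d <= S d * S d.+1.
  case: d d0 {dR Sd Sd1 SS} => // d _.
  apply: le_trans (ler_pM _ _ (S_amgm d) (S_amgm d.+1));
    rewrite ?mulr_ge0 ?exprn_ge0 ?(ltW u0) //.
  rewrite [X in _ <= X]mulrACA ler_wpM2l ?mulr_ge0 //.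
  rewrite uE -exprM -exprD uXle //; lia.
have E1 : d%:R^-1 - d.+1%:R^-1 = (d%:R * d.+1%:R)^-1 :> R.
  have d1n0 : d%:R + 1 != 0 :> R by rewrite natr1 pnatr_eq0.
  by rewrite -natr1; field; rewrite d1n0 gt_eqF.
have E2 : t ^+ d / S d - t ^+ d.+1 / S d.+1 = t ^+ d / (S d * S d.+1).
  rewrite exprS; apply/eqP; rewrite -subr_eq0; apply/eqP.
  transitivity (t ^+ d * (S d.+1 - (S d * t + 1)) / (S d * S d.+1)).
    by field; rewrite !gt_eqF.
  by rewrite SS subrr mulr0 mul0r.
suff : t ^+ d / (S d * S d.+1) <= (d%:R * d.+1%:R)^-1.
  have swap (a b p q : R) : a - b <= p - q -> q - b <= p - a by lra.
  by rewrite -E1 -E2; apply: swap.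
rewrite ler_pdivrMr ?mulr_gt0 // ler_pdivlMl ?mulr_gt0 ?ltr0n //.
Qed.

Variable k : nat.
Hypothesis k0 : (0 < k)%N.
Variable chi : nat -> R[i].
Hypothesis cchi : dchar k chi.
Hypothesis nchi : nonprincipal k chi.
Hypothesis Lv : Lvanish k chi.
Let c n := complex.Re (chi n).

Let Re_le_norm (z : R[i]) (B : R) : normc z <= B -> complex.Re z <= B.
Proof. by apply: le_trans; apply: le_trans (normc_Re z); apply: ler_norm. Qed.

(** Truncating at [X] leaves geometric tails [e d], each at most [t ^ X / (1 - t)]. The three terms
    of the bound come from [Lvanish], from [abel_summation] with [lambda 1 = 1], and from these
    tails. *)
Lemma sum_lambert_le X :
  \sum_(1 <= n < X.+1) t ^+ n * \sum_(d <- divisors n) c d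
   <= k%:R / (X.+1%:R * (1 - t)) + k%:R + X%:R * t ^+ X / (1 - t).
Proof.
have t1' : 0 < 1 - t by rewrite subr_gt0.
pose e d := (t ^+ d) ^+ (X %/ d).+1 / (1 - t ^+ d).
have inner d : (0 < d)%N -> \sum_(1 <= m < (X %/ d).+1) (t ^+ d) ^+ m
    = (d%:R * (1 - t))^-1 - lambda d - e d.
  move=> d0; rewrite /lambda subKr /e -mulrBl; set q := t ^+ d.
  have q1 : 1 - q != 0 by rewrite gt_eqF ?tX1.
  apply: (mulIf q1); rewrite divfK //.
  elim: (X %/ d)%N => [|l IH]; first by rewrite big_geq // mul0r expr1 subrr.
  by rewrite big_nat_recr //= mulrDl IH [q ^+ l.+2]exprS; ring.
have -> : \sum_(1 <= n < X.+1) t ^+ n * \sum_(d <- divisors n) c d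
    = \sum_(1 <= d < X.+1) c d * ((d%:R * (1 - t))^-1 - lambda d - e d).
  transitivity (\sum_(1 <= n < X.+1) \sum_(d <- divisors n)
     c d * (t ^+ d) ^+ (n %/ d)).
    apply: eq_big_nat => n /andP[n0 _]; rewrite mulr_sumr.
    apply: eq_big_seq => d; rewrite -dvdn_divisors // => dn.
    by rewrite mulrC -exprM mulnC divnK.
  rewrite (sum_divisors_exchange X (fun d m => c d * (t ^+ d) ^+ m)).
  by apply: eq_big_nat => d /andP[d0 _]; rewrite -inner // mulr_sumr.
have -> : \sum_(1 <= d < X.+1) c d * ((d%:R * (1 - t))^-1 - lambda d - e d)
  = complex.Re (Lsum chi X) / (1 - t)
    + complex.Re (- \sum_(1 <= d < X.+1) (lambda d)%:C * chi d)
    + \sum_(1 <= d < X.+1) c d * - e d.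
  rewrite ReN !Re_sum -sumrN mulr_suml -!big_split /=; apply: eq_bigr => d _.
  rewrite !ReZ /c invfM; ring.
apply: lerD; first apply: lerD.
- rewrite ler_pdivrMr // invfM mulrA divfK ?gt_eqF //.
  exact/Re_le_norm/Lv.
- apply: Re_le_norm; rewrite normcN.
  have lambda1 : lambda 1 = 1.
    by rewrite /lambda; field; rewrite gt_eqF.
  rewrite (_ : k%:R = k%:R * lambda 1%N); last by rewrite lambda1 mulr1.
  apply: (@abel_summation _ chi lambda) => [i _||]; first exact: dchar_partial_sum.
    exact: lambda_ge0.
  exact: lambda_nonincr.
apply: (@le_trans _ _ (\sum_(1 <= d < X.+1) t ^+ X / (1 - t))); last first.
  by rewrite sumr_const_nat subSS subn0 -mulrA mulr_natl.
rewrite !big_nat ler_sum // => d /andP[d0 _].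
have tdt : t ^+ d <= t by rewrite -[X in _ <= X]expr1 ler_wiXn2l ?ltW.
have e0 : 0 <= e d <= t ^+ X / (1 - t).
  apply/andP; split; first by rewrite divr_ge0 ?exprn_ge0 ?(ltW t0) ?(ltW (tX1 d0)).
  apply: ler_pM; rewrite ?exprn_ge0 ?(ltW t0) ?invr_ge0 ?(ltW (tX1 d0)) //.
    rewrite -exprM ler_wiXn2l ?ltW // mulnC ltnW // ltn_ceil //.
  by rewrite lef_pV2 ?posrE ?tX1 // lerD2l lerN2.
have : `|c d| <= 1 by apply: le_trans (normc_Re _) (dchar_norm _ cchi).
rewrite ler_norml; move: e0; move: (e d) (c d) (_ / _) => x y z; nra.
Qed.

End Lambert.

Lemma sum_squares_le (R : numDomainType) (F : nat -> R) M X :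
  (forall n, (0 < n)%N -> 0 <= F n) -> (M ^ 2 <= X)%N ->
  \sum_(1 <= s < M.+1) F (s ^ 2)%N <= \sum_(1 <= n < X.+1) F n.
Proof.
move=> F0 MX; have sub a b : (0 < a <= b)%N ->
    \sum_(1 <= n < a) F n <= \sum_(1 <= n < b) F n.
  case/andP=> a0 ab; rewrite (@big_cat_nat _ _ _ a 1 b) //= lerDl.
  by rewrite big_nat sumr_ge0 // => n /andP[an _]; apply: F0; lia.
apply: le_trans (sub (M ^ 2).+1 X.+1 _); last by rewrite ltnS.
elim: M {MX} => [|M IH]; first by rewrite !big_geq.
rewrite big_nat_recr //=.
apply: (@le_trans _ _ (\sum_(1 <= n < (M.+1 ^ 2)) F n + F (M.+1 ^ 2)%N)).
  by rewrite lerD2r; apply: le_trans IH (sub _ _ _); nia.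
by rewrite [X in _ <= X]big_nat_recr //= expn_gt0.
Qed.

Lemma Lsum_real (R : realType) k (chi : nat -> R[i]) : (0 < k)%N ->
  dchar k chi -> nonprincipal k chi ->
  (forall n, coprime k n -> chi n ^+ 2 = 1) -> ~ Lvanish k chi.
Proof.
move=> k0 cchi nchi chi2 Lv; pose c n := complex.Re (chi n).
have chi_val n : [\/ chi n = 0, chi n = 1 | chi n = -1].
  have [cn|cn] := boolP (coprime k n); last by constructor 1; rewrite (dchar_eq0 cchi).
  have /eqP := chi2 n cn; rewrite sqrf_eq1 => /orP[] /eqP ->.
    by constructor 2.
  by constructor 3.
have c_val n : [\/ c n = 0, c n = 1 | c n = -1].
  by rewrite /c; case: (chi_val n) => ->; [constructor 1|constructor 2|constructor 3].
have c1 : c 1%N = 1 by rewrite /c (dchar1 cchi).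
have cM m n : c (m * n)%N = c m * c n.
  rewrite /c (dcharM cchi).
  by case: (chi_val m) => ->; rewrite ?mul0r ?mul1r ?mulN1r //; case: (chi n).
(* [T] keeps [t ^ (s ^ 2) >= 1 / 2] for [s <= M], so the squares contribute at least
   [M / 2 = k + 3]. [n] and [X] are large enough for both error terms of [sum_lambert_le] to be at
   most 1, which leaves the upper bound [k + 2]. *)
pose M := (2 * k + 6)%N; pose T := (2 * M ^ 2)%N; pose n := (2 * T ^ 3 * k)%N.
pose X := (2 * n)%N; pose t : R := 1 - T%:R^-1.
have T2 : (2 <= T)%N by rewrite /T; nia.
have TR : 2 <= T%:R :> R by rewrite ler_nat.
have Ti : 0 < T%:R^-1 :> R by rewrite invr_gt0; lra.
have Ti2 : T%:R^-1 <= 2^-1 :> R by rewrite lef_pV2 ?posrE //; lra.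
have t01 : 0 < t < 1 by rewrite /t; apply/andP; split; lra.
have tE : 1 - t = T%:R^-1 by rewrite /t; ring.
have k1 : 1 <= k%:R :> R by rewrite ler1n.
have nR : n%:R = 2 * T%:R ^+ 3 * k%:R :> R by rewrite /n natrM natrM natrX.
have n0 : (0 < n)%N by rewrite -(ltr_nat R) nR mulr_gt0 ?mulr_gt0 ?exprn_gt0 //; lra.
have bern m : 1 - m%:R * T%:R^-1 <= t ^+ m.
  elim: m => [|m IH]; first by rewrite mul0r subr0 expr0.
  case/andP: t01 => t0 t1.
  rewrite exprS -natr1; apply: le_trans (ler_wpM2l (ltW t0) IH).
  have : 0 <= m%:R :> R by [].
  by rewrite /t; move: Ti; move: (_^-1) m%:R => *; nra.
have tn : n%:R * t ^+ n <= T%:R.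
  have H m : (1 + m%:R * T%:R^-1) * t ^+ m <= 1.
    elim: m => [|m IH]; first by rewrite mul0r addr0 expr0 mulr1.
    apply: le_trans IH; rewrite exprS mulrA; case/andP: t01 => t0 t1.
    rewrite ler_wpM2r ?exprn_ge0 ?(ltW t0) // -natr1 /t.
    have : 0 <= m%:R :> R by [].
    by move: Ti; move: (_^-1) m%:R => *; nra.
  have := H n; rewrite -(ler_pM2l (_ : 0 < T%:R)); last by lra.
  rewrite mulr1; apply: le_trans; rewrite mulrA ler_wpM2r //.
    by rewrite exprn_ge0 //; case/andP: t01 => /ltW.
  have Tn0 : T%:R != 0 :> R by rewrite gt_eqF //; lra.
  by rewrite mulrDr mulr1 mulrCA divff // mulr1 lerDr ler0n.
have tX : X%:R * t ^+ X / (1 - t) <= 1.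
  have nR0 : 0 < n%:R :> R by rewrite ltr0n.
  rewrite tE invrK -(ler_pM2r nR0) mul1r.
  have -> : X%:R * t ^+ X * T%:R * n%:R = 2 * T%:R * (n%:R * t ^+ n) ^+ 2 :> R.
    by rewrite /X natrM mulnC exprM; ring.
  apply: (@le_trans _ _ (2 * T%:R * T%:R ^+ 2)).
    rewrite ler_wpM2l ?mulr_ge0 // lerXn2r ?nnegrE ?mulr_ge0 ?exprn_ge0 //.
    by case/andP: t01 => /ltW.
  rewrite nR -mulrA -exprS ler_peMr // mulr_ge0 // exprn_ge0 //.
have kX : k%:R / (X.+1%:R * (1 - t)) <= 1.
  rewrite tE ler_pdivrMr ?mulr_gt0 ?ltr0n // mul1r ler_pdivlMr; last by lra.
  rewrite -natrM ler_nat /X /n; nia.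
have upper := sum_lambert_le t01 k0 cchi nchi Lv X.
have F0 m : (0 < m)%N -> 0 <= t ^+ m * \sum_(d <- divisors m) c d.
  move=> m0; rewrite mulr_ge0 ?exprn_ge0 //; first by case/andP: t01 => /ltW.
  exact: sum_char_divisors_ge0.
have MX : (M ^ 2 <= X)%N by rewrite /X /n /T; nia.
have := sum_squares_le F0 MX.
suff : M%:R / 2 <= \sum_(1 <= s < M.+1) t ^+ (s ^ 2) * \sum_(d <- divisors (s ^ 2)) c d.
  have -> : M%:R = 2 * k%:R + 6 :> R by rewrite /M natrD natrM.
  move: upper tX kX; rewrite -/c.
  by move: (_ / _) (_ * _ / _) (\sum_(_ <= _ < _) _) (\sum_(_ <= _ < _) _) => *; lra.
apply: (@le_trans _ _ (\sum_(1 <= s < M.+1) 2^-1)).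
  by rewrite sumr_const_nat subSS subn0 mulr_natl.
rewrite !big_nat ler_sum // => s /andP[s0 sM].
apply: (@le_trans _ _ (t ^+ (s ^ 2))); last first.
  rewrite ler_peMr ?exprn_ge0 ?sum_char_divisors_sqr //.
  by case/andP: t01 => /ltW.
apply: le_trans (bern _).
have : (s ^ 2)%:R * T%:R^-1 <= 2^-1 :> R.
  rewrite ler_pdivrMr; last by lra.
  rewrite ler_pdivlMl // -natrM ler_nat /T leq_mul2l leq_exp2r //=; lia.
lra.
Qed.

(** * Characters modulo k and primes in arithmetic progressions *)

Lemma prim_root_exists (F : numClosedFieldType) n :
  (0 < n)%N -> exists z : F, n.-primitive_root z.
Proof.
move=> n0; have [r Er] := closed_field_poly_normal ('X^n - 1 : {poly F}).
rewrite (monicP (monicXnsubC 1 n0)) scale1r in Er.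
have r1 : all n.-unity_root r by apply/allP => z; rewrite -root_prod_XsubC -Er.
have sz : (n < (size r).+1)%N by rewrite -(size_prod_XsubC r id) -Er size_XnsubC.
have ur : uniq r by rewrite -separable_prod_XsubC -Er separable_Xn_sub_1 // pnatr_eq0 -lt0n.
by have /hasP[z _ pz] := has_prim_root n0 r1 ur sz; exists z.
Qed.

(** * Orthogonality in the dual of a finite abelian group *)

Section AbelianDual.
Variable gT : finGroupType.
Variable e : nat.
Hypothesis eE : e.+1 = #|gT|.
Hypothesis abG : abelian [set: gT].

(** Characters are kept as exponents, added modulo [e.+1]: they form a finite type, and characters
    found over [algC] can be transported to roots of unity of another field. *)
Definition dual : {set {ffun gT -> 'I_e.+1}} :=
  [set f : {ffun gT -> 'I_e.+1} | [forall x, forall y, f (x * y)%g == f x + f y]].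

Lemma dualP (f : {ffun gT -> 'I_e.+1}) :
  reflect (forall x y, f (x * y)%g = f x + f y) (f \in dual).
Proof.
rewrite inE; apply: (iffP forallP) => [H x y|H x].
  by have /forallP/(_ y)/eqP := H x.
by apply/forallP => y; rewrite H.
Qed.

(** The irreducible characters of an abelian group are linear and their kernels meet trivially;
    their values are powers of [z], whose exponents give [f]. *)
Lemma dual_separates (g : gT) : g != 1%g -> exists2 f, f \in dual & f g != 0.
Proof.
move=> g1; have [z prz] := C_prim_root_exists (ltn0Sn e).
have lin i : 'chi[[set: gT]]_i \is a linear_char by apply: (char_abelianP _ abG).
have [i gi] : exists i, g \notin cfker 'chi[[set: gT]]_i.
  apply/existsP; rewrite -negb_forall; apply: contra g1 => /forallP H.
  have : g \in \bigcap_i cfker 'chi[[set: gT]]_i by apply/bigcapP => j _.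
  by rewrite TI_cfker_irr inE.
have root x : 'chi[[set: gT]]_i x ^+ e.+1 = 1.
  have /dvdnP[m ->] : (#[x]%g %| e.+1)%N by rewrite eE -cardsT order_dvdG ?inE.
  by rewrite mulnC exprM lin_char_unity_root ?inE // expr1n.
pose f := [ffun x => sval (prim_rootP prz (root x))].
have fE x : 'chi[[set: gT]]_i x = z ^+ f x.
  by rewrite ffunE; case: (prim_rootP prz (root x)).
exists f.
  apply/dualP => x y; apply: val_inj => /=; apply/eqP.
  rewrite -[X in X == _](@modn_small _ e.+1) ?ltn_ord // -(eq_prim_root_expr prz).
  by rewrite exprD -!fE lin_charM ?inE.
apply: contra gi => /eqP f0; rewrite cfkerEchar ?irr_char // !inE /=.
by rewrite fE f0 expr0 lin_char1.
Qed.

Variable F : numClosedFieldType.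
Variable w : F.
Hypothesis prw : e.+1.-primitive_root w.

Lemma exprZpD (a b : 'I_e.+1) : w ^+ (a + b)%R = w ^+ a * w ^+ b.
Proof. by rewrite /= (expr_mod _ (prim_expr_order prw)) exprD. Qed.

(** For [g != 1], translation by an [f0] with [f0 g != 0] multiplies the sum by [w ^ f0 g], which is
    not 1. *)
Lemma sum_dual (g : gT) :
  \sum_(f in dual) w ^+ f g = if g == 1%g then #|dual|%:R else 0.
Proof.
case: eqP => [->|/eqP g1].
  rewrite (eq_bigr (fun _ => 1)) ?sumr_const // => f /dualP fM.
  have := fM 1%g 1%g; rewrite mulg1 -{1}[f 1%g]addr0 => /addrI <-.
  by rewrite expr0.
have [f0 f0H f0g] := dual_separates g1.
have w1 : w ^+ f0 g != 1.
  rewrite -(prim_order_dvd prw) /dvdn modn_small ?ltn_ord //.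
apply/eqP; have : w ^+ f0 g * \sum_(f in dual) w ^+ f g == \sum_(f in dual) w ^+ f g.
  rewrite [X in _ == X](reindex_inj (addIr f0)) mulr_sumr; apply/eqP.
  rewrite [RHS](eq_bigl (mem dual)) => [|f] /=.
    by apply: eq_bigr => f _; rewrite ffunE exprZpD mulrC.
  apply/dualP/dualP => H x y; last by rewrite !ffunE H (dualP _ f0H) addrACA.
  have := H x y; rewrite !ffunE (dualP _ f0H) addrACA; exact: addIr.
by rewrite -subr_eq0 -[X in _ - X]mul1r -mulrBl mulf_eq0 subr_eq0 (negPf w1).
Qed.

End AbelianDual.

Section Residues.
Variable k : nat.
Hypothesis k1 : (1 < k)%N.

(** Integers not prime to [k] are sent to the default 1; the characters mask it by testing
    coprimality first. *)
Definition residue (n : nat) : {unit 'Z_k} := insubd (1%g : {unit 'Z_k}) (n%:R : 'Z_k).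

Lemma residueE n : coprime k n -> val (residue n) = n%:R.
Proof. by move=> cn; rewrite val_insubd unitZpE // cn. Qed.

Lemma residueM m n : coprime k m -> coprime k n ->
  residue (m * n) = (residue m * residue n)%g.
Proof.
move=> cm cn; apply: val_inj; rewrite residueE ?coprimeMr ?cm //.
by rewrite FinRing.val_unitM !residueE // natrM.
Qed.

Lemma residue_mod n : residue (n %% k) = residue n.
Proof. by rewrite /residue Zp_nat_mod ?k1. Qed.

Lemma residue_eq1 n : coprime k n -> (residue n == 1%g) = (n == 1 %[mod k]).
Proof.
move=> cn; rewrite -val_eqE /= residueE //= -[1 in X in X = _]/(1%:R).
by rewrite -val_eqE /= val_Zp_nat // Zp_cast.
Qed.

Lemma residue_surj (x : {unit 'Z_k}) :
  coprime k (val x : 'Z_k) /\ residue (val x : 'Z_k) = x.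
Proof.
have xE : ((val x : 'Z_k) : nat)%:R = val x by rewrite natr_Zp.
have cx : coprime k (val x : 'Z_k) by rewrite -unitZpE // xE; exact: (valP x).
by split=> //; apply: val_inj; rewrite residueE.
Qed.

End Residues.

Lemma dirichlet_characters (R : rcfType) k : (1 < k)%N ->
  exists (I : finType) (D : {set I}) (X : I -> nat -> R[i]) (i0 : I),
  [/\ i0 \in D, forall i, i \in D -> dchar k (X i),
      forall n, coprime k n -> X i0 n = 1,
      forall i, i \in D -> i != i0 -> nonprincipal k (X i) &
      forall n, \sum_(i in D) X i n = if n == 1 %[mod k] then #|D|%:R else 0].
Proof.
move=> k1; pose gT : finGroupType := {unit 'Z_k}; pose e := #|gT|.-1.
have eE : e.+1 = #|gT| by rewrite prednK //; apply/card_gt0P; exists 1%g.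
have abG : abelian [set: gT].
  by apply/centsP => x _ y _; apply: val_inj; rewrite !FinRing.val_unitM mulrC.
have [w prw] := prim_root_exists R[i] (ltn0Sn e).
have normw j : normc (w ^+ j) = 1.
  have normX i : normc (w ^+ i) = normc w ^+ i.
    by elim: i => [|i IH]; rewrite ?normc1 // !exprS normcM IH.
  have : normc w ^+ e.+1 == 1 by rewrite -normX (prim_expr_order prw) normc1.
  by rewrite pexpr_eq1 ?normc_ge0 // normX => /eqP ->; rewrite expr1n.
pose X (f : {ffun gT -> 'I_e.+1}) n : R[i] := if coprime k n then w ^+ f (residue k n) else 0.
exists {ffun gT -> 'I_e.+1}, (dual gT e), X, 0; split.
- by apply/dualP => x y; rewrite !ffunE addr0.
- move=> f /dualP fM; split=> [|m n|n|n cn|n cn]; rewrite /X.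
  + rewrite coprimen1; have -> : residue k 1 = 1%g.
      by apply/eqP; rewrite residue_eq1 ?coprimen1.
    have := fM 1%g 1%g; rewrite mulg1 -{1}[f 1%g]addr0 => /addrI <-.
    by rewrite expr0.
  + rewrite coprimeMr; case cm: (coprime k m); last by rewrite mul0r.
    case cn: (coprime k n); last by rewrite mulr0.
    by rewrite residueM // fM exprZpD.
  + by rewrite coprime_modr residue_mod.
  + by rewrite (negPf cn).
  + by rewrite cn normw.
- by move=> n cn; rewrite /X cn ffunE expr0.
- move=> f fD f0; have [x fx] : exists x, f x != 0.
    apply/existsP; apply: contraR f0; rewrite negb_exists => /forallP H.
    apply/eqP/ffunP => x; rewrite ffunE; apply/eqP; have := H x.
    by rewrite negbK.
  have [cx xE] := residue_surj k1 x.
  exists (val x : 'Z_k) => //; rewrite /X cx xE.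
  by rewrite -(prim_order_dvd prw) /dvdn modn_small ?ltn_ord.
move=> n; case cn: (coprime k n); last first.
  rewrite big1 => [|f _]; last by rewrite /X cn.
  case: eqP => // n1; have := coprimen1 k; rewrite -coprime_modr -n1.
  by rewrite coprime_modr cn.
rewrite -residue_eq1 // -(sum_dual eE abG prw).
by apply: eq_bigr => f _; rewrite /X cn.
Qed.

Lemma sum_le_range (R : numDomainType) (g : nat -> R) (P : pred nat) k x :
  (forall n, 0 <= g n) -> (forall n, P n -> (n <= k)%N) ->
  \sum_(1 <= n < x.+1 | P n) g n <= \sum_(1 <= n < k.+1) g n.
Proof.
move=> g0 Pk.
apply: (@le_trans _ _ (\sum_(1 <= n < (x + k).+1 | P n) g n)).
  rewrite [X in _ <= X](@big_cat_nat _ _ _ x.+1) ?ltnS ?leq_addr //= lerDl.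
  by rewrite sumr_ge0.
rewrite (@big_cat_nat _ _ _ k.+1) ?ltnS ?leq_addl //=.
rewrite [X in _ + X]big_nat_cond [X in _ + X]big1 ?addr0.
  by rewrite big_mkcond ler_sum // => n _; case: ifP.
by move=> n /andP[/andP[kn _] /Pk]; rewrite leqNgt kn.
Qed.

Lemma eventually_bounded_sum (R : rcfType) (I : eqType) (s : seq I)
    (P : pred I) (f : I -> nat -> R[i]) :
  (forall i, P i -> exists C : R, exists x0, forall x, (x0 <= x)%N -> normc (f i x) <= C) ->
  exists C : R, exists x0, forall x, (x0 <= x)%N ->
    normc (\sum_(i <- s | P i) f i x) <= C.
Proof.
move=> H; elim: s => [|i s [C [x0 IH]]].
  by exists 0, 0%N => x _; rewrite big_nil normc0.
have [Pi|nPi] := boolP (P i); last first.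
  by exists C, x0 => x xx; rewrite big_cons (negPf nPi) IH.
have [C' [x1 H']] := H i Pi; exists (C' + C), (maxn x0 x1) => x.
rewrite geq_max => /andP[xx0 xx1]; rewrite big_cons Pi.
by apply: le_trans (ler_normcD _ _) (lerD (H' _ xx1) (IH _ xx0)).
Qed.

Lemma Psum_nonprincipal_bounded (R : realType) k (chi : nat -> R[i]) :
  (0 < k)%N -> dchar k chi -> nonprincipal k chi ->
  exists C : R, exists x0, forall x, (x0 <= x)%N -> normc (Psum chi x) <= C.
Proof.
move=> k0 cchi nchi; apply: (Psum_bounded k0) => //.
have [nchi2|nchi2] := EM (nonprincipal k (fun n => chi n ^+ 2)).
  exact: Lsum_complex.
(* Here [chi ^ 2] is 1 on all integers prime to [k], so the character is real. *)
apply: Lsum_real => // n cn; apply/eqP; apply: contrapT => /negP H.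
by apply: nchi2; exists n.
Qed.

Section Dirichlet.
Variable R : realType.

Lemma mangoldt_div_ge0 n : 0 <= mangoldt R n / n%:R.
Proof. by rewrite divr_ge0 ?mangoldt_ge0. Qed.

(** Serves for the primes dividing [k] as well as for the supposedly finite set of primes congruent
    to [a]. The nonprime terms cost at most 2. *)
Lemma sum_mangoldt_prime_le (P : pred nat) N x :
  (forall n, P n -> prime n -> (n <= N)%N) ->
  \sum_(1 <= n < x.+1 | P n) mangoldt R n / n%:R
   <= \sum_(1 <= n < N.+1) mangoldt R n / n%:R + 2.
Proof.
move=> PN; rewrite (bigID prime) /=; apply: lerD.
  apply: sum_le_range => [n|n /andP[]]; [exact: mangoldt_div_ge0|exact: PN].
apply: le_trans (sum_mangoldt_nonprime R x).
rewrite [X in _ <= X](bigID P) /= -[X in X <= _]addr0 lerD ?sumr_ge0 //.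
  by rewrite le_eqVlt; apply/orP; left; apply/eqP; apply: eq_bigl => n; rewrite andbC.
by move=> n _; exact: mangoldt_div_ge0.
Qed.

End Dirichlet.

Theorem dirichlet_primes k a N : (1 < k)%N -> coprime k a ->
  exists p, [/\ (N < p)%N, prime p & p = a %[mod k]].
Proof.
move=> k1 cka; have k0 := ltnW k1.
pose R : realType := Rdefinitions.R.
apply: contrapT => noprime.
(* [X i b] takes the place of the conjugate of [X i a] in the orthogonality relation. *)
have [b ab] : exists b, (a * b = 1 %[mod k])%N.
  case: (posnP a) => [a0|a0].
    by move: cka; rewrite a0 /coprime gcdn0 => /eqP kE; move: k1; rewrite kE.
  case: (egcdnP k a0) => u v E _; exists u; rewrite mulnC E gcdnC (eqP cka).
  by rewrite modnMDl.
have cb : coprime k b.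
  have : coprime k (a * b) by rewrite -coprime_modr ab coprime_modr coprimen1.
  by rewrite coprimeMr => /andP[].
have cong n : (n * b == 1 %[mod k]) = (n == a %[mod k]).
  apply/eqP/eqP => H; last by rewrite -modnMml H modnMml ab.
  rewrite -[n]muln1 -modnMmr -ab modnMmr mulnCA -modnMmr H modnMmr muln1 //.
have [I [D [X [i0 [i0D XD X0 Xn Xsum]]]]] := dirichlet_characters R k1.
pose A x := \sum_(1 <= n < x.+1 | n == a %[mod k]) mangoldt R n / n%:R.
have AE x : (#|D|%:R * A x)%:C = \sum_(i in D) X i b * Psum (X i) x.
  transitivity (\sum_(1 <= n < x.+1) (mangoldt R n / n%:R)%:C
                  * \sum_(i in D) X i (n * b)%N).
    rewrite /A mulr_sumr rmorph_sum big_mkcond /=; apply: eq_bigr => n _.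
    rewrite Xsum cong; case: ifP => _; last by rewrite mulr0.
    by rewrite rmorphM mulrC rmorph_nat.
  under eq_bigr do rewrite mulr_sumr.
  rewrite exchange_big /=; apply: eq_bigr => i iD.
  rewrite mulr_sumr; apply: eq_bigr => n _.
  by rewrite (dcharM (XD i iD)); ring.
have [C [x0 HC]] : exists C : R, exists x0, forall x, (x0 <= x)%N ->
    normc (\sum_(i in D | i != i0) X i b * Psum (X i) x) <= C.
  apply: eventually_bounded_sum => i /andP[iD ii0].
  have [C [x0 HC]] := Psum_nonprincipal_bounded k0 (XD i iD) (Xn i iD ii0).
  exists C, x0 => x xx0; rewrite normcM; apply: le_trans (HC x xx0).
  by rewrite ler_piMl ?normc_ge0 // (dchar_norm _ (XD i iD)).
have principal x : (0 < x)%N ->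
    ln x%:R - 1 - (\sum_(1 <= n < k.+1) mangoldt R n / n%:R + 2)
    <= complex.Re (Psum (X i0) x).
  move=> x_gt0; rewrite lerBlDr; apply: le_trans (mertens_ge R x_gt0) _.
  rewrite (bigID (coprime k)) /= lerD //.
    rewrite Re_sum big_mkcond ler_sum // => n _; rewrite ReZ.
    case: ifP => cn; first by rewrite X0 // mulr1.
    by rewrite (dchar_eq0 (XD _ i0D)) ?cn // mulr0.
  apply: sum_mangoldt_prime_le => n cn pn.
  by apply: dvdn_leq => //; rewrite coprime_sym prime_coprime // negbK in cn.
have upper x : A x <= \sum_(1 <= n < N.+1) mangoldt R n / n%:R + 2.
  apply: sum_mangoldt_prime_le => n /eqP na pn; rewrite leqNgt; apply/negP => Nn.
  by apply: noprime; exists n.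
set B1 := \sum_(1 <= n < k.+1) _ in principal.
set B2 := \sum_(1 <= n < N.+1) _ in upper.
(* For this [x] the principal character outweighs the others, so that [#|D| * A x] would exceed
   [#|D| * (B2 + 2)]. *)
have [x x0x lnx] := ln_unbounded (1 + (B1 + 2) + C + #|D|%:R * (B2 + 2)) x0.
have x_gt0 : (0 < x)%N by apply: leq_ltn_trans x0x.
have := congr1 (@complex.Re R) (AE x).
rewrite Re_real (bigD1 i0) //= ReD X0 // mul1r => E.
have H1 := principal x x_gt0; have H2 := HC x (ltnW x0x).
have H3 := normc_Re (\sum_(i in D | i != i0) X i b * Psum (X i) x).
have H4 : #|D|%:R * A x <= #|D|%:R * (B2 + 2) :> R by rewrite ler_wpM2l // upper.
move: H3; rewrite ler_norml => /andP[H3 _].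
move: E H1 H2 H3 H4 lnx.
set u := complex.Re _; set v := complex.Re _; set n := normc _.
lra.
Qed.

(** * Covering by divisors of Fermat numbers *)

From Stdlib Require Import NArith DecimalNat.

Local Open Scope nat_scope.

(* The divisions are in binary, so that large primes are not expanded in unary. *)
Lemma prime_trial_division (q : N) (b : nat) :
  (1 <? q)%num -> (q <? N.of_nat b * N.of_nat b)%num ->
  all (fun d => ~~ (q mod N.of_nat d =? 0)%num) (iota 2 (b - 2)) ->
  prime (N.to_nat q).
Proof.
move=> /N.ltb_lt q1 /N.ltb_lt qb /allP nodiv.
have q1' : 1 < N.to_nat q by lia.
have qb' : N.to_nat q < b ^ 2 by rewrite -mulnn; lia.
apply: ltn_pdiv2_prime; first exact: ltnW.
rewrite (leq_trans qb') // leq_exp2r // leqNgt; apply/negP => pb.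
have p1 := prime_gt1 (pdiv_prime q1').
have /nodiv/negP[] : pdiv (N.to_nat q) \in iota 2 (b - 2).
  by rewrite mem_iota p1 /=; lia.
apply/N.eqb_eq; have := pdiv_dvd (N.to_nat q).
move: (pdiv _) => d /dvdnP[c E].
have -> : q = (N.of_nat c * N.of_nat d)%num by lia.
exact: N.Div0.mod_mul.
Qed.

Lemma nat_65537 : 65537 = N.to_nat 65537.
Proof.
rewrite /Nat.of_num_uint Unsigned.of_uint_alt.
by cbv beta iota delta [Decimal.rev Decimal.revapp Unsigned.of_lu]; lia.
Qed.

Lemma nat_6700417 : 6700417 = N.to_nat 6700417.
Proof.
rewrite /Nat.of_num_uint Unsigned.of_uint_alt.
by cbv beta iota delta [Decimal.rev Decimal.revapp Unsigned.of_lu]; lia.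
Qed.

(** The bounds 257 here and 2589 below are the least integers whose squares exceed the number
    tested. *)
Lemma prime_65537 : prime 65537.
Proof. by rewrite nat_65537; apply: (@prime_trial_division _ 257); vm_compute. Qed.

Lemma prime_6700417 : prime 6700417.
Proof. by rewrite nat_6700417; apply: (@prime_trial_division _ 2589); vm_compute. Qed.

Lemma fermat4 : 65537 = (2 ^ (2 ^ 4)).+1.
Proof.
have -> : 2 ^ 4 = 8 * 2 by [].
rewrite expnM; have -> : 2 ^ 8 = 256 by [].
by rewrite nat_65537 -mulnn; lia.
Qed.

Lemma fermat5 : 641 * 6700417 = (2 ^ (2 ^ 5)).+1.
Proof.
have -> : 2 ^ 5 = 8 * 4 by [].
rewrite expnM; have -> : 2 ^ 8 = 256 by [].
by rewrite nat_6700417 !expnS expn0; lia.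
Qed.

Lemma gt641_65537 : 641 < 65537.
Proof. by rewrite nat_65537; lia. Qed.

Lemma gt641_6700417 : 641 < 6700417.
Proof. by rewrite nat_6700417; lia. Qed.

Lemma eq_mod_dvdn d m x y : d %| m -> x = y %[mod m] -> x = y %[mod d].
Proof. by move=> dm xy; rewrite -(modn_dvdm x dm) xy modn_dvdm. Qed.

Lemma sqr_eq1_modS x : 0 < x -> x ^ 2 = 1 %[mod x.+1].
Proof.
by case: x => // x _; rewrite (_ : x.+1 ^ 2 = x * x.+2 + 1) ?modnMDl //; lia.
Qed.

Lemma expn_even_modS x m : 0 < x -> x ^ m.*2 = 1 %[mod x.+1].
Proof. by move=> x0; rewrite -mul2n expnM -modnXm sqr_eq1_modS // modnXm exp1n. Qed.

Lemma dvdn_Xodd_add1 x m : 0 < x -> odd m -> x.+1 %| (x ^ m).+1.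
Proof.
move=> x0 om; rewrite /dvdn -(odd_double_half m) om add1n expnS -addn1.
by rewrite -modnDml -modnMmr expn_even_modS // modnMmr muln1 modnDml addn1 modnn.
Qed.

(** [2 ^ (2 ^ i)] is -1 modulo [q], hence so is its odd power, and the value is [r - p] modulo
    [q]. *)
Lemma cover_odd i q p r c : odd c -> q %| (2 ^ (2 ^ i)).+1 -> p = r %[mod q] ->
  q %| 2 ^ (2 ^ i * c) * p + r.
Proof.
move=> oc qF pr; rewrite /dvdn -modnDml -modnMmr pr modnMmr modnDml.
rewrite addnC -mulSn -/(dvdn _ _) dvdn_mulr // expnM.
by apply: dvdn_trans qF _; rewrite dvdn_Xodd_add1 ?expn_gt0.
Qed.

(** One more squaring turns -1 into 1, and the value becomes [p + r]. *)
Lemma cover_even i q p r c : q %| (2 ^ (2 ^ i)).+1 -> q %| p + r ->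
  q %| 2 ^ (2 ^ i.+1 * c) * p + r.
Proof.
move=> qF qpr; have E : 2 ^ (2 ^ i.+1 * c) = 1 %[mod q].
  have <- : (1 %% (2 ^ (2 ^ i)).+1) %% q = 1 %% q by rewrite modn_dvdm.
  rewrite expnS -mulnA mulnCA expnM mul2n.
  by rewrite -(@expn_even_modS _ c) ?expn_gt0 // modn_dvdm.
by rewrite /dvdn -modnDml -modnMml E modnMml mul1n modnDml.
Qed.

Lemma schemmel_neq r p a n : prime p -> r < p -> 3 %| p - r -> 3 < p ->
  (forall b, ~~ prime (2 ^ b * p + r)) -> schemmel r n <> 2 ^ a * p.
Proof.
move=> pp rp pr3 p3 comp E.
have term q : q \in primes n ->
    (if q <= r then 0 else q ^ (logn q n).-1 * (q - r)) %| 2 ^ a * p.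
  by move=> qn; rewrite -E /schemmel (big_rem q) //= dvdn_mulr.
have : p %| schemmel r n by rewrite E dvdn_mull.
rewrite /schemmel Euclid_dvd_prod // big_has => /hasP[q qn].
have pq : prime q by move: qn; rewrite mem_primes => /and3P[].
(* A prime factor [q <= r] would contribute a factor 0, which cannot divide [2 ^ a * p]. *)
have := term q qn; case: leqP => [_|rq].
  by rewrite dvd0n muln_eq0 expn_eq0 /= => /eqP p0; rewrite p0 in pp.
move=> H; rewrite Euclid_dvdM // => /orP[|/dvdnP[t qE]].
  rewrite Euclid_dvdX // dvdn_prime2 // => /andP[/eqP pE _]; subst q.
  (* For [q = p] the factor [p - r] would carry the prime 3 into [2 ^ a * p]. *)
  have : 3 %| 2 ^ a * p by apply: dvdn_trans pr3 (dvdn_trans (dvdn_mull _ _) H).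
  rewrite Euclid_dvdM // Euclid_dvdX // dvdn_prime2 // => /orP[/andP[]//|].
  by rewrite dvdn_prime2 // => /eqP p3E; rewrite -p3E in p3.
(* [q - r = t * p] divides [2 ^ a * p], so [t] is a power of 2 and [q] is one of the numbers that
   [comp] declares composite. *)
have : t * p %| 2 ^ a * p by rewrite -qE; apply: dvdn_trans H; apply: dvdn_mull.
rewrite dvdn_pmul2r ?prime_gt0 // => /(dvdn_pfactor _ _ (isT : prime 2))[b _ tE].
have := comp b; rewrite -tE -qE subnK ?pq //; exact: ltnW.
Qed.

Lemma dvdn_641_fermat5 : 641 %| (2 ^ (2 ^ 5)).+1.
Proof. rewrite -fermat5; exact: dvdn_mulr. Qed.

(* Writing [b = 2 ^ i * d] with [d] odd, the Fermat number [2 ^ 2 ^ i + 1]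
   divides [2 ^ b + 1], which settles [i <= 5]; for [i >= 6], or [b = 0],
   [641] divides [2 ^ b - 1]. *)
Lemma covering_divisor (f : nat -> nat) p r b :
  (forall i, i < 6 ->
     [/\ 1 < f i, f i < p, f i %| (2 ^ (2 ^ i)).+1 & p = r %[mod f i]]) ->
  641 %| p + r -> 641 < p -> exists2 q, 1 < q < p & q %| 2 ^ b * p + r.
Proof.
move=> fP pr641 p641; case: (posnP b) => [->|b0].
  by exists 641; rewrite ?p641 // expn0 mul1n.
have [d od ->] := pfactor_coprime (isT : prime 2) b0.
rewrite coprime2n in od; rewrite [d * _]mulnC; move: (logn 2 b) => i.
have [/fP[f1 fp fF pr]|i6] := ltnP i 6.
  exists (f i); first by rewrite f1.
  exact: cover_odd od fF pr.
exists 641; first by rewrite p641.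
have -> : 2 ^ i * d = 2 ^ 6 * (2 ^ (i - 6) * d) by rewrite mulnA -expnD subnKC.
exact: cover_even dvdn_641_fermat5 pr641.
Qed.

(** From the fifth Fermat number the factor 6700417 is taken, 641 being reserved for the larger
    valuations; [f i != 641] keeps the two kinds of congruences compatible. *)
Lemma fermat_prime_factors r :
  ~~ (3 %| r) -> ~~ (5 %| r) -> ~~ (17 %| r) -> ~~ (257 %| r) ->
  ~~ (65537 %| r) -> ~~ (6700417 %| r) ->
  exists2 f : nat -> nat, f 0 = 3 & forall i, i < 6 ->
    [/\ prime (f i), f i != 641, ~~ (f i %| r) & f i %| (2 ^ (2 ^ i)).+1].
Proof.
move=> r3 r5 r17 r257 rP rQ.
(* No [done] here: it would evaluate the hypotheses [~~ (6700417 %| r)] in unary. *)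
exists (fun i => nth 0 [:: 3; 5; 17; 257; 65537; 6700417] i); first reflexivity.
case=> [|[|[|[|[|[|i]]]]]] i6; rewrite [nth _ _ _]/=.
- by split; [exact: isT|exact: isT|exact: r3|exact: isT].
- by split; [exact: isT|exact: isT|exact: r5|exact: isT].
- by split; [exact: isT|exact: isT|exact: r17|exact: isT].
- by split; [exact: isT|exact: isT|exact: r257|exact: isT].
- split; [exact: prime_65537| |exact: rP|].
    rewrite (gtn_eqF gt641_65537); exact: isT.
  rewrite -fermat4; exact: dvdnn.
- split; [exact: prime_6700417| |exact: rQ|].
    rewrite (gtn_eqF gt641_6700417); exact: isT.
  rewrite -fermat5; exact (dvdn_mull 641 (dvdnn 6700417)).
- case: (notF i6).
Qed.

Lemma prime_congruent_opposite641 m r B :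
  coprime m 641 -> coprime m r -> ~~ (641 %| r) ->
  exists p, [/\ B < p, prime p, p = r %[mod m] & 641 %| p + r].
Proof.
move=> cm641 cmr r641.
(* 640 stands for -1 modulo 641. *)
have [c c1 c2] : exists2 c, c = r %[mod m] & c = 640 * r %[mod 641].
  by exists (chinese m 641 r (640 * r)); [apply: chinese_modl|apply: chinese_modr].
have cc : coprime (m * 641) c.
  rewrite coprimeMl -coprime_modr c1 coprime_modr cmr.
  rewrite -coprime_modr c2 coprime_modr coprimeMr.
  by rewrite (@prime_coprime 641 r).
have m0 : 0 < m by rewrite lt0n; apply: contraL cm641 => /eqP ->.
have mk : 1 < m * 641 by apply: leq_trans (leq_pmull 641 m0).
have [p [Bp pp pc]] := dirichlet_primes B mk cc.
exists p; split; [exact: Bp|exact: pp| |].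
  rewrite -c1; exact: eq_mod_dvdn (dvdn_mulr _ (dvdnn m)) pc.
have H : p = 640 * r %[mod 641].
  by rewrite -c2; apply: eq_mod_dvdn (dvdn_mull _ (dvdnn 641)) pc.
by rewrite /dvdn -modnDml H modnDml addnC -mulSn modnMr.
Qed.

Theorem theorem3p3 (r : nat) :
  0 < r -> odd r ->
  ~~ (3 %| r) -> ~~ (5 %| r) -> ~~ (17 %| r) -> ~~ (257 %| r) ->
  ~~ (641 %| r) -> ~~ (65537 %| r) -> ~~ (6700417 %| r) ->
  forall N : nat, exists p : nat,
    N < p /\ prime p /\ forall a : nat, in_G r (2 ^ a * p).
Proof.
move=> _ _ r3 r5 r17 r257 r641 rP rQ N.
have [f f0 fP] := fermat_prime_factors r3 r5 r17 r257 rP rQ.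
clear r3 r5 r17 r257 rP rQ.
pose m := \prod_(i < 6) f i.
have fm i : i < 6 -> f i %| m.
  by move=> i6; rewrite /m (bigD1 (Ordinal i6)) // dvdn_mulr.
have p641 : prime 641 by [].
have coprime_m x : (forall i, i < 6 -> coprime (f i) x) -> coprime m x.
  move=> H; rewrite /m; elim/big_ind: _ => [|y z yx zx|i _].
  - exact: coprime1n.
  - by rewrite coprimeMl yx.
  - exact: H.
have cm641 : coprime m 641.
  apply: coprime_m => i /fP[pf f641 _ _].
  by rewrite (prime_coprime _ pf) (dvdn_prime2 pf p641).
have cmr : coprime m r.
  by apply: coprime_m => i /fP[pf _ fr _]; rewrite (prime_coprime _ pf).
(* Beyond this bound [p] exceeds [N], [r], 641 and every [f i], so the covering divisors are
   proper. *)
have [p [Bp pp prm pr641]] :=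
  prime_congruent_opposite641 (N + r + 641 + \sum_(i < 6) f i) cm641 cmr r641.
clear cm641 cmr coprime_m.
have [NLp rp p641p] : [/\ N < p, r < p & 641 < p] by clear -Bp; split; lia.
have fp i : i < 6 -> f i < p.
  move=> i6; apply: leq_ltn_trans Bp; rewrite (bigD1 (Ordinal i6) isT).
  exact: leq_trans (leq_addr _ _) (leq_addl _ _).
have pr i : i < 6 -> p = r %[mod f i] by move=> /fm fim; apply: eq_mod_dvdn fim _.
exists p; split; first exact: NLp.
split; first exact: pp.
move=> a; split; first by rewrite muln_gt0 expn_gt0 (prime_gt0 pp).
case=> n [_]; apply: (schemmel_neq pp rp) => [||b].
- rewrite -(eqn_mod_dvd _ (ltnW rp)) -f0; apply/eqP; exact: pr.
- exact: ltn_trans p641p.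
have [|q /andP[q1 qp] dq] := @covering_divisor f p r b _ pr641 p641p.
  move=> i i6; have [pf _ _ fF] := fP i i6.
  by split; [exact: prime_gt1|exact: fp|exact: fF|exact: pr].
apply/negP => /primeP[_ /(_ _ dq)]; rewrite (gtn_eqF q1) /= => /eqP qE.
have : p <= 2 ^ b * p + r.
  by apply: leq_trans (leq_addr _ _); apply: leq_pmull; rewrite expn_gt0.
by rewrite -qE leqNgt qp.
Qed.
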